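(* Let $G_1,G_2$ be distribution functions on $\mathbb{R}$. The $(G_1,G_2)$-transformed rank correlation coefficient $\kappa_{G_1,G_2}$ is a measure of concordance if and only if both $G_1$ and $G_2$ are of the same type as some non-degenerate symmetric distribution $G$ with finite second moment.
   Context: For a distribution function $G:\mathbb{R}\to[0,1]$, the quantile function is $G^{-1}(p)=\inf\{x\in\mathbb{R}: G(x)\ge p\}$, $p\in(0,1)$. For a random vector $(X_1,X_2)$ with continuous marginal distribution functions $F_1,F_2$, the $(G_1,G_2)$-transformed rank correlation coefficient is $\kappa_{G_1,G_2}(X_1,X_2)=\rho\bigl(G_1^{-1}(F_1(X_1)),G_2^{-1}(F_2(X_2))\bigr)$, where $\rho$ is Pearson's correlation coefficient (defined only for non-degenerate random variables with finite second moments). It depends only on the copula $C$ of $(X_1,X_2)$ and is also written $\kappa_{G_1,G_2}(C)$. Two distributions are of the same type if one is a location-scale transform of the other, i.e. $Y_2\overset{d}{=}cY_1+m$ with $c>0$, $m\in\mathbb{R}$. A distribution is symmetric if $Y-m\overset{d}{=}m-Y$ for some $m\in\mathbb{R}$, where $Y$ has that distribution. A measure of concordance (in the sense of Scarsini) is a map $\kappa$ assigning a real number to pairs of continuously distributed random variables such that: (1) Domain: $\kappa(X_1,X_2)$ is defined for all pairs of continuously distributed $X_1,X_2$; (2) Symmetry: $\kappa(X_1,X_2)=\kappa(X_2,X_1)$; (3) Coherence: if the copulas $C_1,C_2$ of $(X_1,X_2)$, $(X_1',X_2')$ satisfy $C_1(u_1,u_2)\le C_2(u_1,u_2)$ for all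 $u_1,u_2\in[0,1]$, then $\kappa(X_1,X_2)\le\kappa(X_1',X_2')$; (4) Range: $-1\le\kappa(X_1,X_2)\le 1$, with $\kappa=1$ if $(X_1,X_2)$ is comonotone (copula $\min\{u_1,u_2\}$) and $\kappa=-1$ if it is countermonotone (copula $\max\{u_1+u_2-1,0\}$); (5) Independence: $\kappa(X_1,X_2)=0$ if $X_1,X_2$ are independent; (6) Change of sign: $\kappa(X_1,-X_2)=-\kappa(X_1,X_2)$; (7) Continuity: if $(X_{n1},X_{n2})\sim H_n$ and $(X_1,X_2)\sim H$ have continuous margins and $H_n\to H$ pointwise, then $\kappa(X_{n1},X_{n2})\to\kappa(X_1,X_2)$. *)

(* Defs.v *)
From HB Require Import structures.
From mathcomp Require Import all_boot all_order all_algebra.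
From mathcomp Require Import all_classical all_reals all_analysis.
From mathcomp Require Import measurable_realfun.

Set Implicit Arguments.
Unset Strict Implicit.
Unset Printing Implicit Defensive.

Import Order.TTheory GRing.Theory Num.Theory.
Import numFieldNormedType.Exports.

Local Open Scope classical_set_scope.
Local Open Scope ring_scope.

(* The type [cumulativeBounded 0 1] is the type of distribution functions on R:
   nondecreasing, right-continuous, with limits 0 at -oo and 1 at +oo. *)
Definition law (R : realType) (G : cumulativeBounded (0 : R) (1 : R)) :
  probability (measurableTypeR R) R := lebesgue_stieltjes_measure G.

(* Only meaningful for 0 < p < 1: outside, the set may be empty or unbounded
   below, in which case [inf] returns 0. *)
Definition quantile (R : realType) (G : R -> R) (p : R) : R :=
  inf [set x | p <= G x].

Section random_variables.
Context d (T : measurableType d) (R : realType) (P : probability T R).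

Definition distr_fun (X : {RV P >-> R}) (x : R) : R := fine (cdf X x).

Definition continuously_distributed (X : {RV P >-> R}) : Prop :=
  continuous (distr_fun X).

Definition joint_distr_fun (X1 X2 : {RV P >-> R}) (x1 x2 : R) : R :=
  fine (P [set w | X1 w <= x1 /\ X2 w <= x2]).

Definition independent_RV (X1 X2 : {RV P >-> R}) : Prop :=
  forall A B : set R, measurable A -> measurable B ->
    P (X1 @^-1` A `&` X2 @^-1` B) = (P (X1 @^-1` A) * P (X2 @^-1` B))%E.

Definition opp_RV (X : {RV P >-> R}) : {RV P >-> R} :=
  - (X : {mfun T >-> R}).

Definition non_degenerate (Y : T -> R) : Prop :=
  forall c : R, ~ {ae P, forall w, Y w = c}.

Definition finite_second_moment (Y : T -> R) : Prop :=
  ('E_P[Y ^+ 2] < +oo)%E.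

Definition pearson_defined (Y1 Y2 : T -> R) : Prop :=
  [/\ non_degenerate Y1, finite_second_moment Y1,
      non_degenerate Y2 & finite_second_moment Y2].

Definition pearson (Y1 Y2 : T -> R) : R :=
  fine (covariance P Y1 Y2) /
    (Num.sqrt (fine 'V_P[Y1]) * Num.sqrt (fine 'V_P[Y2])).

Definition rank_transform (G : R -> R) (X : {RV P >-> R}) : T -> R :=
  fun w => quantile G (distr_fun X (X w)).

End random_variables.

Section copulas.
Context (R : realType).

Definition is_copula (C : R -> R -> R) : Prop :=
  [/\ forall u, 0 <= u <= 1 -> C u 0 = 0 /\ C 0 u = 0,
      forall u, 0 <= u <= 1 -> C u 1 = u /\ C 1 u = u &
      forall u1 v1 u2 v2, 0 <= u1 -> u1 <= v1 -> v1 <= 1 ->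
        0 <= u2 -> u2 <= v2 -> v2 <= 1 ->
        0 <= C v1 v2 - C v1 u2 - C u1 v2 + C u1 u2].

(* Sklar's relation; for continuous margins it determines C on [0,1]^2. The
   values of C outside the unit square are irrelevant. *)
Definition copula_of d (T : measurableType d) (P : probability T R)
    (X1 X2 : {RV P >-> R}) (C : R -> R -> R) : Prop :=
  is_copula C /\
  forall x1 x2, joint_distr_fun X1 X2 x1 x2 =
                C (distr_fun X1 x1) (distr_fun X2 x2).

Definition comonotone_copula (u1 u2 : R) : R := Num.min u1 u2.

Definition countermonotone_copula (u1 u2 : R) : R := Num.max (u1 + u2 - 1) 0.

End copulas.

(* A partially defined real functional of pairs of random variables on a common
   (arbitrary) probability space; [value] is only meaningful where [defined]
   holds. *)
Record coefficient (R : realType) := Coefficient {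
  defined : forall (d : measure_display) (T : measurableType d)
    (P : probability T R), {RV P >-> R} -> {RV P >-> R} -> Prop;
  value : forall (d : measure_display) (T : measurableType d)
    (P : probability T R), {RV P >-> R} -> {RV P >-> R} -> R }.

Arguments defined {R} c {d T P} X1 X2 : rename.
Arguments value {R} c {d T P} X1 X2 : rename.

Record measure_of_concordance (R : realType) (k : coefficient R) : Prop := {
  concordance_domain :
    forall (d : measure_display) (T : measurableType d) (P : probability T R)
      (X1 X2 : {RV P >-> R}),
    continuously_distributed X1 -> continuously_distributed X2 ->
    defined k X1 X2;
  concordance_symmetry :
    forall (d : measure_display) (T : measurableType d) (P : probability T R)
      (X1 X2 : {RV P >-> R}),
    continuously_distributed X1 -> continuously_distributed X2 ->
    value k X1 X2 = value k X2 X1;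
  concordance_coherence :
    forall (d : measure_display) (T : measurableType d) (P : probability T R)
      (X1 X2 : {RV P >-> R})
      (d' : measure_display) (T' : measurableType d') (P' : probability T' R)
      (X1' X2' : {RV P' >-> R}) (C C' : R -> R -> R),
    continuously_distributed X1 -> continuously_distributed X2 ->
    continuously_distributed X1' -> continuously_distributed X2' ->
    copula_of X1 X2 C -> copula_of X1' X2' C' ->
    (forall u1 u2, 0 <= u1 <= 1 -> 0 <= u2 <= 1 -> C u1 u2 <= C' u1 u2) ->
    value k X1 X2 <= value k X1' X2';
  concordance_range :
    forall (d : measure_display) (T : measurableType d) (P : probability T R)
      (X1 X2 : {RV P >-> R}),
    continuously_distributed X1 -> continuously_distributed X2 ->
    [/\ -1 <= value k X1 X2 <= 1,
        copula_of X1 X2 (@comonotone_copula R) -> value k X1 X2 = 1 &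
        copula_of X1 X2 (@countermonotone_copula R) -> value k X1 X2 = -1];
  concordance_independence :
    forall (d : measure_display) (T : measurableType d) (P : probability T R)
      (X1 X2 : {RV P >-> R}),
    continuously_distributed X1 -> continuously_distributed X2 ->
    independent_RV X1 X2 -> value k X1 X2 = 0;
  concordance_change_of_sign :
    forall (d : measure_display) (T : measurableType d) (P : probability T R)
      (X1 X2 : {RV P >-> R}),
    continuously_distributed X1 -> continuously_distributed X2 ->
    value k X1 (opp_RV X2) = - value k X1 X2;
  concordance_continuity :
    forall (d : nat -> measure_display) (T : forall n, measurableType (d n))
      (P : forall n, probability (T n) R) (X1 X2 : forall n, {RV (P n) >-> R})
      (d' : measure_display) (T' : measurableType d') (P' : probability T' R)
      (X1' X2' : {RV P' >-> R}),
    (forall n, continuously_distributed (X1 n)) ->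
    (forall n, continuously_distributed (X2 n)) ->
    continuously_distributed X1' -> continuously_distributed X2' ->
    (forall x1 x2, joint_distr_fun (X1 n) (X2 n) x1 x2 @[n --> \oo]
                     --> joint_distr_fun X1' X2' x1 x2) ->
    value k (X1 n) (X2 n) @[n --> \oo] --> value k X1' X2' }.

Definition transformed_rank_corr (R : realType) (G1 G2 : R -> R) :
    coefficient R :=
  {| defined := fun d T P X1 X2 =>
       pearson_defined P (rank_transform G1 X1) (rank_transform G2 X2);
     value := fun d T P X1 X2 =>
       pearson P (rank_transform G1 X1) (rank_transform G2 X2) |}.

Section distributions.
Context (R : realType).
Implicit Types G : cumulativeBounded (0 : R) (1 : R).

(* If Y has distribution G then c * Y + m has distribution G'. *)
Definition same_type G G' : Prop :=
  exists c m : R, 0 < c /\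
    forall A : set R, measurable A ->
      law G' A = pushforward (law G) (fun y : R => c * y + m) A.

Definition symmetric_distr G : Prop :=
  exists m : R, forall A : set R, measurable A ->
    pushforward (law G) (fun y : R => y - m) A =
    pushforward (law G) (fun y : R => m - y) A.

Definition non_degenerate_distr G : Prop :=
  non_degenerate (law G) (fun y : R => y).

Definition finite_second_moment_distr G : Prop :=
  finite_second_moment (law G) (fun y : R => y).

End distributions.

(* Main.v *)
Require Import Defs.
From HB Require Import structures.
From mathcomp Require Import all_boot all_order all_algebra.
From mathcomp Require Import all_classical all_reals all_analysis.
From mathcomp Require Import measurable_realfun.
From mathcomp Require Import ring lra.

Set Implicit Arguments.
Unset Strict Implicit.
Unset Printing Implicit Defensive.

Import Order.TTheory GRing.Theory Num.Theory.
Import numFieldNormedType.Exports.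

Local Open Scope classical_set_scope.
Local Open Scope ring_scope.

(** Write [q1], [q2] for the quantile functions of [G1], [G2], and call
    [F(X)] the grade of [X], where [F] is the distribution function of [X].
    When [F] is continuous the grade is uniform on [0, 1], so [q_i(F_i(X_i))]
    has law [G_i] ([rank_transform_law]); in particular its variance does not
    depend on [X_i], and the coefficient is a covariance divided by a constant.

    The conditions on [G] are necessary. On any space carrying a continuously
    distributed [X], the pair [(X, X)] is comonotone, so the coefficient is 1
    there, and -1 on [(X, -X)] by change of sign. A correlation equal to 1 or
    -1 forces an affine relation ([extremal_correlation]): almost surely
    [q2(F(X)) = c Y + m] and [q2(1 - F(X)) = - c Y + m'], with [Y = q1(F(X))]
    and [c > 0]. The left-hand sides both have law [G2]. The first relation
    says that [G2] is of the type of [G1]; the equality of the laws of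
    [c Y + m] and [- c Y + m'] says that [G1] is symmetric. Hence [G = G1].

    They are sufficient. Quantile functions of distributions of the same type
    are affine images of each other, so both [G_i] may be replaced by [G]
    ([pearson_rank_transform]). The key estimate is [cov_step_bound]: replacing
    [Y_i = q(F_i(X_i))] by a rounding [s_n(Y_i)], where [s_n] is a staircase
    function converging to the identity in L2 of the law [G], the covariance of
    [Y_1] and [Y_2] is, up to an error depending on [n] and [G] only, a finite
    combination with nonnegative coefficients of the numbers
    [K(G t_i, G t_j) - G t_i * G t_j], where [K] is the joint distribution
    function of the grades ([grade_copula]), which coincides with the copula.
    Monotonicity in the copula, the value 0 under independence and continuity
    are visible on these finite sums, and survive in the limit since the error
    is uniform. For continuity one also needs that convergence of joint
    distribution functions implies convergence of the copulas
    ([cvg_grade_copula]). Change of sign holds because symmetry of [G] about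
    [m] gives [q(1 - u) = 2 m - q(u)] for almost every [u]
    ([rank_transform_opp]). The bounds are the Cauchy-Schwarz inequality;
    finally the coefficient only depends on the copula, so the comonotone and
    countermonotone cases may be computed on [(X, X)] and [(X, -X)]. *)

(** * Covariance of square-integrable functions *)

Section square_integrable.
Context d (T : measurableType d) (R : realType) (P : probability T R).
Implicit Types X Y Z : T -> R.

Lemma L2_measurable X : X \in Lfun P 2%:E -> measurable_fun setT X.
Proof. by rewrite inE => /andP[]; rewrite inE. Qed.

Lemma L2_L1 X : X \in Lfun P 2%:E -> X \in Lfun P 1.
Proof. by apply: Lfun_subset12; exact: fin_num_measure. Qed.

Lemma L2_M X Y : X \in Lfun P 2%:E -> Y \in Lfun P 2%:E -> (X * Y) \in Lfun P 1.
Proof. exact: Lfun2_mul_Lfun1. Qed.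

Lemma second_moment_L2 X : measurable_fun setT X -> finite_second_moment P X ->
  X \in Lfun P 2%:E.
Proof.
move=> mX; rewrite /finite_second_moment unlock => X2.
rewrite inE; apply/andP; split; rewrite inE//= /finite_norm unlock poweR_lty//.
under eq_integral do rewrite /= powR_mulrn// -normrX ger0_norm ?sqr_ge0//.
exact: X2.
Qed.

Lemma L2_sqr_fin_num X : X \in Lfun P 2%:E -> 'E_P[X ^+ 2]%E \is a fin_num.
Proof. by move=> X2; rewrite expectation_fin_num// expr2 L2_M. Qed.

Lemma L2_D X Y : X \in Lfun P 2%:E -> Y \in Lfun P 2%:E ->
  (X \+ Y) \in Lfun P 2%:E.
Proof. by move=> X2 Y2; rewrite rpredD// lee1n. Qed.

Lemma L2_B X Y : X \in Lfun P 2%:E -> Y \in Lfun P 2%:E ->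
  (X \- Y) \in Lfun P 2%:E.
Proof. by move=> X2 Y2; rewrite rpredB// lee1n. Qed.

Lemma L2_Z a X : X \in Lfun P 2%:E -> (a \o* X) \in Lfun P 2%:E.
Proof. by move=> X2; rewrite Lfun_scale// ler1n. Qed.

(** Real-valued covariance; meaningful when both arguments are in L2. *)
Definition cov X Y : R := fine (covariance P X Y).
(** Real-valued variance; meaningful on L2. *)
Definition var X : R := fine 'V_P[X].

Lemma covC X Y : cov X Y = cov Y X.
Proof. by rewrite /cov covarianceC. Qed.

Lemma var_ge0 X : 0 <= var X.
Proof. by rewrite /var fine_ge0// variance_ge0. Qed.

Lemma cov_finE X Y : X \in Lfun P 2%:E -> Y \in Lfun P 2%:E ->
  (cov X Y)%:E = covariance P X Y.
Proof.
by move=> X2 Y2; rewrite fineK// covariance_fin_num// ?L2_M//; exact: L2_L1.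
Qed.

Lemma covDl X Y Z : X \in Lfun P 2%:E -> Y \in Lfun P 2%:E ->
  Z \in Lfun P 2%:E -> cov (X \+ Y) Z = cov X Z + cov Y Z.
Proof.
move=> X2 Y2 Z2; apply: EFin_inj; rewrite EFinD !cov_finE ?covarianceDl//.
exact: L2_D.
Qed.

Lemma covZl a X Y : X \in Lfun P 2%:E -> Y \in Lfun P 2%:E ->
  cov (a \o* X) Y = a * cov X Y.
Proof.
move=> X2 Y2; apply: EFin_inj; rewrite EFinM !cov_finE ?covarianceZl ?L2_M//;
  by [exact: L2_L1|exact: L2_Z].
Qed.

Lemma covBl X Y Z : X \in Lfun P 2%:E -> Y \in Lfun P 2%:E ->
  Z \in Lfun P 2%:E -> cov (X \- Y) Z = cov X Z - cov Y Z.
Proof.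
move=> X2 Y2 Z2; apply: EFin_inj; rewrite EFinB !cov_finE ?covarianceBl//.
exact: L2_B.
Qed.

Lemma covBr X Y Z : X \in Lfun P 2%:E -> Y \in Lfun P 2%:E ->
  Z \in Lfun P 2%:E -> cov X (Y \- Z) = cov X Y - cov X Z.
Proof. by move=> X2 Y2 Z2; rewrite covC covBl// ![cov _ X]covC. Qed.

(** Bilinear expansion of the covariance around [(X, Y)]. *)
Lemma cov_perturbation X Y X' Y' :
  X \in Lfun P 2%:E -> Y \in Lfun P 2%:E ->
  X' \in Lfun P 2%:E -> Y' \in Lfun P 2%:E ->
  cov X' Y' = cov X Y +
    (cov (X' \- X) Y + cov X (Y' \- Y) + cov (X' \- X) (Y' \- Y)).
Proof.
move=> X2 Y2 X'2 Y'2.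
by rewrite !covBl ?L2_B// !covBr//; ring.
Qed.

Lemma cov_cst_l c X : cov (cst c) X = 0.
Proof. by rewrite /cov covariance_cst_l. Qed.

Lemma var_fin_numE X : X \in Lfun P 2%:E -> (var X)%:E = 'V_P[X]%E.
Proof. by move=> X2; rewrite fineK// variance_fin_num. Qed.

Lemma varZ a X : X \in Lfun P 2%:E -> var (a \o* X) = a ^+ 2 * var X.
Proof. by move=> X2; rewrite /var varianceZ// fineM// variance_fin_num. Qed.

Lemma varB X Y : X \in Lfun P 2%:E -> Y \in Lfun P 2%:E ->
  var (X \- Y) = var X + var Y - 2 * cov X Y.
Proof.
move=> X2 Y2; apply: EFin_inj.
rewrite EFinB EFinD EFinM (cov_finE X2 Y2) !var_fin_numE ?L2_B//.
by rewrite varianceB.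
Qed.

(** The Cauchy-Schwarz inequality. *)
Lemma normr_cov_le X Y : X \in Lfun P 2%:E -> Y \in Lfun P 2%:E ->
  `|cov X Y| <= Num.sqrt (var X) * Num.sqrt (var Y).
Proof.
have cov_le U V : U \in Lfun P 2%:E -> V \in Lfun P 2%:E ->
    cov U V <= Num.sqrt (var U) * Num.sqrt (var V).
  move=> U2 V2; have := covariance_le U2 V2.
  by rewrite -cov_finE// -!var_fin_numE// -EFinM lee_fin.
move=> X2 Y2; rewrite ler_norml cov_le// andbT lerNl.
have := cov_le _ _ (L2_Z (-1) X2) Y2.
by rewrite covZl// varZ// mulN1r sqrrN expr1n mul1r.
Qed.

Lemma var_le_second_moment X : X \in Lfun P 2%:E ->
  var X <= fine 'E_P[X ^+ 2]%E.
Proof.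
move=> X2; rewrite -lee_fin var_fin_numE// fineK ?L2_sqr_fin_num//.
rewrite varianceE// -(fineK (expectation_fin_num (L2_L1 X2))) -EFin_expe.
by rewrite leeBlDr// leeDl// lee_fin sqr_ge0.
Qed.

Lemma var0_ae_cst X : X \in Lfun P 2%:E -> var X = 0 ->
  {ae P, forall w, X w = fine 'E_P[X]%E}.
Proof.
move=> X2 v0; have := var_fin_numE X2.
rewrite v0 /variance covariance.unlock expectation.unlock.
set c := fine _ => i0.
have mX := L2_measurable X2.
have mX2 : measurable_fun setT (fun w => ((X w - c) ^+ 2)%:E).
  by apply/measurable_EFinP; apply: measurable_funX; exact: measurable_funB.
have [+ _] := ae_eq_integral_abs P measurableT mX2.
have -> : (\int[P]_w `|((X w - c) ^+ 2)%:E| = 0)%E.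
  rewrite [RHS]i0; apply: eq_integral => w _.
  by rewrite gee0_abs// lee_fin sqr_ge0.
move=> /(_ erefl); apply: filterS => w /(_ I) /= [] /eqP.
by rewrite sqrf_eq0 subr_eq0 => /eqP.
Qed.

Lemma ae_eq_cov X X' Y Y' :
  measurable_fun setT X -> measurable_fun setT X' ->
  measurable_fun setT Y -> measurable_fun setT Y' ->
  {ae P, forall w, X w = X' w} -> {ae P, forall w, Y w = Y' w} ->
  covariance P X Y = covariance P X' Y'.
Proof.
move=> mX mX' mY mY' XX' YY'; rewrite covariance.unlock.
have eE U V : measurable_fun setT U -> measurable_fun setT V ->
    {ae P, forall w, U w = V w} -> 'E_P[U]%E = 'E_P[V]%E.
  move=> mU mV UV; rewrite expectation.unlock; apply: ae_eq_integral => //;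
    [exact/measurable_EFinP|exact/measurable_EFinP|].
  by apply: filterS UV => w -> .
rewrite (eE X X')// (eE Y Y')//; apply: eE.
- by apply: measurable_funM; exact: measurable_funB.
- by apply: measurable_funM; exact: measurable_funB.
- apply: filterS2 XX' YY' => w /= e1 e2.
  by rewrite !fctE /= e1 e2.
Qed.

End square_integrable.

(** * Distribution functions, laws and quantiles *)

Section distribution_functions.
Context (R : realType).
Implicit Types G : cumulativeBounded (0 : R) (1 : R).

Lemma measurable_ray (x : R) : measurable [set y : R | y <= x].
Proof. by rewrite -set_itvNyc; exact: measurable_itv. Qed.

Lemma law_itv G x : law G [set y | y <= x] = (G x)%:E.
Proof.
rewrite -[RHS]cdf_lebesgue_stieltjes_id.
by rewrite /cdf /distribution /pushforward preimage_id set_itvE.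
Qed.

Lemma cumulative_itv G x : 0 <= G x <= 1.
Proof.
rewrite -!lee_fin -law_itv measure_ge0/=; apply: probability_le1.
exact: measurable_ray.
Qed.

(** A probability measure on the line is determined by its distribution
    function. *)
Lemma law_unique G (mu : probability (measurableTypeR R) R) :
  (forall x : R, mu [set y | y <= x] = (G x)%:E) ->
  forall A, measurable A -> mu A = law G A.
Proof.
move=> muG A mA.
apply/esym/lebesgue_stieltjes_measure_unique => // _ [[a b]] _ <-.
suff itvE (nu : probability (measurableTypeR R) R) :
    (forall x : R, nu [set y | y <= x] = (G x)%:E) ->
    nu `]a, b]%classic = (if (a <= b)%R then ((G b)%:E - (G a)%:E) else 0)%E.
  by rewrite [RHS]itvE//; apply: (itvE (law G)) => x; exact: law_itv.
move=> nuG; case: leP => [ab|ba]; last first.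
  by rewrite set_itv_ge ?measure0// bnd_simp -leNgt ltW.
have -> : `]a, b]%classic = [set y | y <= b] `\` [set y | y <= a].
  apply/seteqP; split => y /=; rewrite in_itv/=.
    by move=> /andP[ay yb]; split => //; apply/negP; rewrite -ltNge.
  by move=> [yb /negP]; rewrite -ltNge yb => ->.
rewrite measureD; first last.
- by rewrite -ge0_fin_numE ?fin_num_measure//; exact: measurable_ray.
- exact: measurable_ray.
- exact: measurable_ray.
rewrite setIidr; first by congr (_ - _)%E; exact: nuG.
by move=> y /= /le_trans; exact.
Qed.

(** The Galois connection between a distribution function and its quantile
    function. It may fail for [p] outside ]0, 1[, where [quantile] may take
    a default value. *)
Lemma quantileP G p x : 0 < p < 1 -> (quantile G p <= x) = (p <= G x).
Proof.
move=> /andP[p0 p1]; rewrite /quantile.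
have Gnd : {homo G : a b / a <= b} by exact: cumulative_is_nondecreasing.
have S0 : [set y | p <= G y] !=set0.
  have : \forall y \near +oo, p <= G y by exact: cvgr_ge (cumulativey G) _ p1.
  by move=> [M [_ GM]]; exists (M + 1); apply: GM; rewrite ltrDl.
have SL : has_lbound [set y | p <= G y].
  have : \forall y \near -oo, G y < p by exact: cvgr_lt (cumulativeNy G) _ p0.
  move=> [M [_ GM]]; exists (M - 1) => y /= py.
  rewrite leNgt; apply/negP => yM.
  have := GM (M - 1); rewrite ltrBlDr ltrDl ltr01 => /(_ isT).
  by rewrite ltNge (le_trans py)// Gnd// ltW.
apply/idP/idP => [qx|px]; last exact: ge_inf.
apply: le_trans (Gnd _ _ qx).
set q := inf _.
have Gq : G y @[y --> q^'+] --> G q by exact: cumulative_is_right_continuous.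
(* Right continuity: every y > q lies above an element of the set. *)
apply: (cvgr_to_ge Gq); near=> y.
have qy : q < y by near: y; exact: nbhs_right_gt.
have [z /= pz zy] := inf_lt S0 qy.
by rewrite (le_trans pz)// Gnd// ltW.
Unshelve. all: by end_near. Qed.

End distribution_functions.

(** * Grades of continuously distributed random variables *)

Section quantile_measurable.
Context (R : realType) (G : cumulativeBounded (0 : R) (1 : R)).

(** Outside ]0, 1[ the default values have to be treated separately: the
    quantile function is constant for [p <= 0] and for [p > 1]. *)
Lemma measurable_quantile : measurable_fun setT (quantile G).
Proof.
have -> : [set: R] = `]0, 1[ `|` (`]-oo, 0] `|` ([set 1] `|` `]1, +oo[)).
  apply/seteqP; split => // p _ /=; rewrite !in_itv/= andbT.
  case: (leP p 0) => p0; first by right; left.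
  by case: (ltgtP p 1) => p1; [left|right; right; right|right; right; left].
have mI (i : interval R) : measurable [set` i] by exact: measurable_itv.
have m1 : measurable ([set 1] `|` `]1, +oo[ : set R) by exact: measurableU.
have m2 : measurable (`]-oo, 0] `|` ([set 1] `|` `]1, +oo[) : set R).
  exact: measurableU.
apply/(measurable_funU _ (mI _) m2); split; last first.
  apply/(measurable_funU _ (mI _) m1); split.
    apply: (eq_measurable_fun (cst (quantile G 0))) => // p.
    rewrite inE/= in_itv/= => p0; congr inf; apply/seteqP.
    by split => x /= _; have /andP[G0 _] := cumulative_itv G x;
      rewrite ?(le_trans p0).
  apply/(measurable_funU _ (measurable_set1 _) (mI _)); split.
    exact: measurable_fun_set1.
  apply: (eq_measurable_fun (cst (quantile G 2))) => // p.
  rewrite inE/= in_itv/= andbT => p1; congr inf; apply/seteqP.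
  split => x /= Gx; have /andP[_ G1] := cumulative_itv G x.
    by have := le_trans Gx G1; rewrite lern1.
  by have := le_trans Gx G1; rewrite leNgt p1.
apply: (measurability (@RGenOInfty.G R)) => [|/= _ [_] [x] -> <-].
  exact: RGenOInfty.measurableE.
have -> : `]0, 1[ `&` quantile G @^-1` `]x, +oo[ = `]0, 1[ `&` `](G x), +oo[.
  apply/seteqP; split => p /=; rewrite !in_itv/= !andbT => -[p01 h].
    by split => //; rewrite ltNge -quantileP// -ltNge.
  by split => //; rewrite ltNge quantileP// -ltNge.
exact: measurableI.
Qed.

End quantile_measurable.

Section continuous_random_variables.
Context d (T : measurableType d) (R : realType) (P : probability T R).
Implicit Types X : {RV P >-> R}.

Lemma measurable_RV_le X x : measurable [set w | X w <= x].
Proof.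
rewrite (_ : [set w | _] = X @^-1` [set y | y <= x])//.
rewrite -[X @^-1` _]setTI.
by apply: measurable_funP => //; exact: measurable_ray.
Qed.

Lemma distr_funE X x : (distr_fun X x)%:E = P [set w | X w <= x].
Proof.
by rewrite /distr_fun fineK ?fin_num_measure.
Qed.

Lemma distr_fun_nd X : {homo distr_fun X : x y / x <= y}.
Proof.
by move=> x y xy; rewrite fine_le ?fin_num_measure// cdf_nondecreasing.
Qed.

Lemma distr_fun_itv X x : 0 <= distr_fun X x <= 1.
Proof.
rewrite -!lee_fin distr_funE measure_ge0/=; apply: probability_le1.
exact: measurable_RV_le.
Qed.

Lemma distr_fun_cvgy X : distr_fun X @ +oo --> (1 : R).
Proof. exact/fine_cvg/cvg_cdfy1. Qed.

Lemma distr_fun_cvgNy X : distr_fun X @ -oo --> (0 : R).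
Proof. exact/fine_cvg/cvg_cdfNy0. Qed.

(** By continuity the lower level set at [u] of the distribution function is a
    closed half-line, at whose endpoint the value is exactly [u]. *)
Lemma distr_fun_level X u : continuously_distributed X -> 0 < u < 1 ->
  exists x, distr_fun X x = u /\ forall y, (distr_fun X y <= u) = (y <= x).
Proof.
move=> cX /andP[u0 u1]; set F := distr_fun X.
have Fnd : {homo F : x y / x <= y} by exact: distr_fun_nd.
have S0 : [set y | F y <= u] !=set0.
  have : \forall y \near -oo, F y <= u.
    exact: cvgr_le (distr_fun_cvgNy X) _ u0.
  by move=> [M [_ FM]]; exists (M - 1); apply: FM; rewrite ltrBlDr ltrDl.
have SU : has_ubound [set y | F y <= u].
  have : \forall y \near +oo, u < F y by exact: cvgr_gt (distr_fun_cvgy X) _ u1.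
  move=> [M [_ FM]]; exists (M + 1) => y /= py.
  rewrite leNgt; apply/negP => yM.
  have := FM (M + 1); rewrite ltrDl ltr01 => /(_ isT).
  by rewrite ltNge (le_trans _ py)// Fnd// ltW.
(* Left continuity at the supremum gives F x <= u, right continuity F x >= u. *)
pose x := sup [set y | F y <= u].
have Fxu : F x <= u.
  have : F y @[y --> x^'-] --> F x by apply: cvg_at_left_filter; exact: cX.
  move=> /cvgr_to_le; apply; near=> y.
  have yx : y < x by near: y; exact: nbhs_left_lt.
  have [z /= zu /ltW yz] := sup_gt S0 yx.
  by rewrite (le_trans _ zu)// Fnd.
have levelP y : (F y <= u) = (y <= x).
  apply/idP/idP => [yu|/Fnd/le_trans]; last exact.
  exact: ub_le_sup.
exists x; split => //; apply/eqP; rewrite eq_le Fxu/=.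
have : F y @[y --> x^'+] --> F x by apply: cvg_at_right_filter; exact: cX.
move=> /cvgr_to_ge; apply; near=> y.
by rewrite ltW// ltNge levelP -ltNge; near: y; exact: nbhs_right_gt.
Unshelve. all: by end_near. Qed.

Lemma measurable_distr_fun X : measurable_fun setT (distr_fun X).
Proof. by apply: nondecreasing_measurable => //; exact: distr_fun_nd. Qed.

Lemma measurable_grade X : measurable_fun setT (fun w => distr_fun X (X w)).
Proof. by apply: measurableT_comp => //; exact: measurable_distr_fun. Qed.

Lemma measurable_rank_transform (G : cumulativeBounded (0 : R) (1 : R)) X :
  measurable_fun setT (rank_transform G X).
Proof.
apply: measurableT_comp; first exact: measurable_quantile.
exact: measurable_grade.
Qed.

Lemma measurable_grade_le X u : measurable [set w | distr_fun X (X w) <= u].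
Proof.
rewrite -[X in measurable X]setTI.
by apply: (measurable_grade X measurableT (measurable_ray u)).
Qed.

(** The probability integral transform. *)
Lemma grade_uniform X u : continuously_distributed X -> 0 <= u <= 1 ->
  P [set w | distr_fun X (X w) <= u] = u%:E.
Proof.
move=> cX.
have unif v : 0 < v < 1 -> P [set w | distr_fun X (X w) <= v] = v%:E.
  move=> /(distr_fun_level cX)[x [Fx level]].
  by rewrite -[in RHS]Fx distr_funE; congr (P _); apply/seteqP; split => w /=;
    rewrite level.
move=> /andP[]; rewrite le_eqVlt => /predU1P[<-|u0].
  move=> _; apply/eqP; rewrite eq_le measure_ge0 andbT.
  apply/lee_addgt0Pr => e e0; rewrite add0e.
  have e'01 : 0 < Num.min e (1 / 2) < 1 by rewrite lt_min gt_min e0/=; lra.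
  (* {U <= 0} is contained in {U <= v}, where v = min e (1/2) is in ]0, 1[. *)
  apply: (@le_trans _ _ (Num.min e (1 / 2))%:E).
    rewrite -(unif _ e'01); apply: le_measure; rewrite ?inE;
      try exact: measurable_grade_le.
    by move=> w /= /le_trans; apply; case/andP : e'01 => /ltW.
  by rewrite lee_fin ge_min lexx.
rewrite le_eqVlt => /predU1P[->|u1]; last by rewrite unif// u0.
rewrite (_ : [set w | _] = setT) ?probability_setT//.
by apply/seteqP; split => // w _ /=; case/andP : (distr_fun_itv X (X w)).
Qed.

Lemma ae_grade_itv X : continuously_distributed X ->
  {ae P, forall w, 0 < distr_fun X (X w) < 1}.
Proof.
move=> cX; set U := fun w => distr_fun X (X w).
have U0 : {ae P, forall w, 0 < U w}.
  exists [set w | U w <= 0]; split => [||w /= /negP]; last by rewrite -leNgt.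
    exact: measurable_grade_le.
  by rewrite grade_uniform// lexx ler01.
suff U1 : {ae P, forall w, U w < 1} by apply: filterS2 U0 U1 => w /= -> ->.
have mU1 : measurable [set w | U w < 1].
  rewrite -[X in measurable X]setTI.
  have := measurable_grade X measurableT (measurable_itv `]-oo, 1[).
  by rewrite set_itvE.
exists (~` [set w | U w < 1]); split => //; first exact: measurableC.
rewrite probability_setC//.
apply/eqP; rewrite eq_le; apply/andP; split; last first.
  by rewrite sube_ge0 ?probability_le1// fin_num_measure.
rewrite leeBlDr ?fin_num_measure// add0e.
apply/lee_subgt0Pr => e e0; rewrite -EFinB.
have : 0 < Num.max (1 - e) (1 / 2) < 1 by rewrite lt_max gt_max; lra.
set v := Num.max _ _ => v01.
apply: (@le_trans _ _ v%:E); first by rewrite lee_fin le_max lexx.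
have v01' : 0 <= v <= 1 by case/andP: v01 => /ltW -> /ltW ->.
rewrite -(grade_uniform cX v01').
apply: le_measure; rewrite ?inE//; first exact: measurable_grade_le.
by move=> w /= /le_lt_trans; apply; case/andP: v01.
Qed.

End continuous_random_variables.

(** * Random variables with a prescribed law *)

Section random_variables_with_a_given_law.
Context d (T : measurableType d) (R : realType) (P : probability T R).
Implicit Types (G : cumulativeBounded (0 : R) (1 : R)) (Y : T -> R).

Lemma ae_eq_measure (A B : set T) : measurable A -> measurable B ->
  {ae P, forall w, A w <-> B w} -> P A = P B.
Proof.
move=> mA mB AB.
have H (C : set T) : measurable C -> P C = (\int[P]_w (\1_C w)%:E)%E.
  by move=> mC; rewrite integral_indic// setIT.
rewrite !H//; apply: ge0_ae_eq_integral => //.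
- by apply/measurable_EFinP; exact: measurable_indic.
- by apply/measurable_EFinP; exact: measurable_indic.
apply: filterS AB => w [AB BA] _; rewrite !indicE; congr (_%:R%:E).
by congr nat_of_bool; apply/idP/idP; rewrite !inE.
Qed.

Lemma ae_le_measure (A B : set T) : measurable A -> measurable B ->
  {ae P, forall w, A w -> B w} -> (P A <= P B)%E.
Proof.
move=> mA mB AB; have mAB := measurableI _ _ mA mB.
rewrite (@ae_eq_measure A (A `&` B))//.
  by apply: le_measure; rewrite ?inE//; exact: subIsetr.
by apply: filterS AB => w AB; split => [Aw|[]//]; split => //; exact: AB.
Qed.

(** [Y] is a random variable whose law is the one with distribution function
    [G]. *)
Definition has_law Y G := measurable_fun setT Y /\
  forall A : set R, measurable A -> P (Y @^-1` A) = law G A.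

Lemma has_law_integral Y G (f : R -> \bar R) : has_law Y G ->
  measurable_fun setT f -> (forall y, 0 <= f y)%E ->
  (\int[P]_w f (Y w) = \int[law G]_y f y)%E.
Proof.
move=> [mY lY] mf f0.
have := @ge0_integral_pushforward _ _ T (measurableTypeR R) R Y mY P setT f
  measurableT mf.
rewrite preimage_setT => /(_ (fun y _ => f0 y)) <-.
apply: eq_measure_integral => A mA _; exact: lY.
Qed.

Lemma has_law_of_cdf Y G : measurable_fun setT Y ->
  (forall x, P [set w | Y w <= x] = (G x)%:E) -> has_law Y G.
Proof.
move=> mY YG; split => // A mA.
pose mY' := @isMeasurableFun.Build _ _ T (measurableTypeR R) Y mY.
pose Y' : {mfun T >-> measurableTypeR R} := HB.pack Y mY'.
exact: (@law_unique _ G (distribution P Y') YG).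
Qed.

Lemma has_law_cdf Y G x : has_law Y G -> P [set w | Y w <= x] = (G x)%:E.
Proof. by move=> [_ /(_ _ (measurable_ray x))] ->; exact: law_itv. Qed.

Lemma has_law_expectation Y G : has_law Y G ->
  ('E_P[Y] = 'E_(law G)[(fun y : R => y)])%E.
Proof.
move=> YG; rewrite expectation.unlock [LHS]integralE [RHS]integralE.
have mE : measurable_fun setT (EFin : R -> \bar R) by exact: EFin_measurable.
congr (_ - _)%E.
- rewrite -(has_law_integral YG (measurable_funepos mE) (funepos_ge0 _)).
  by apply: eq_integral => w _; rewrite !funeposE.
- rewrite -(has_law_integral YG (measurable_funeneg mE) (funeneg_ge0 _)).
  by apply: eq_integral => w _; rewrite !funenegE.
Qed.

Lemma has_law_second_moment Y G (f : R -> R) : has_law Y G ->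
  measurable_fun setT f ->
  ('E_P[(f \o Y) ^+ 2] = 'E_(law G)[f ^+ 2])%E.
Proof.
move=> YG mf; rewrite expectation.unlock.
rewrite -(has_law_integral (f:=fun y => ((f ^+ 2) y)%:E) YG)//; last first.
  by move=> y; rewrite lee_fin sqr_ge0.
by apply/measurable_EFinP; rewrite expr2; exact: measurable_funM.
Qed.

Lemma has_law_variance Y G : has_law Y G ->
  ('V_P[Y] = 'V_(law G)[(fun y : R => y)])%E.
Proof.
move=> YG; rewrite /variance covariance.unlock (has_law_expectation YG).
set c := cst _; rewrite -expr2.
rewrite -(@has_law_second_moment Y G
  (fun y : R => y - fine 'E_(law G)[(fun y0 : R => y0)]%E) YG)//.
exact: measurable_funB.
Qed.

Lemma has_law_finite_second_moment Y G : has_law Y G ->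
  finite_second_moment P Y <-> finite_second_moment_distr G.
Proof.
move=> YG; rewrite /finite_second_moment_distr /finite_second_moment.
by rewrite -(has_law_second_moment YG (f:=id)).
Qed.

(** Non-degeneracy, stated on a probability space, is a property of the law:
    [{Y = c}] is almost sure iff the law does not charge the complement
    of [c]. *)
Lemma has_law_non_degenerate Y G : has_law Y G ->
  non_degenerate P Y <-> non_degenerate_distr G.
Proof.
move=> [mY YG]; rewrite /non_degenerate_distr /non_degenerate.
have m1 (c : R) : measurable (~` [set c] : set R) by exact: measurableC.
have E1 (c : R) : {ae P, forall w, Y w = c} <-> law G (~` [set c]) = 0%E.
  rewrite -YG//; split => [|h].
    move=> /negligibleP h; apply: h; rewrite -[X in measurable X]setTI.
    exact: (mY measurableT _ (m1 c)).
  exists (Y @^-1` (~` [set c])); split => //.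
  by rewrite -[X in measurable X]setTI; exact: (mY measurableT _ (m1 c)).
have E2 (c : R) : {ae law G, forall y : R, y = c} <-> law G (~` [set c]) = 0%E.
  split => [/negligibleP h|h]; first by apply: h; exact: m1.
  by exists (~` [set c]); split => //; exact: m1.
by split => h c; have := h c; rewrite (propext (E1 c)) (propext (E2 c)).
Qed.

Lemma rank_transform_ae_le G (X : {RV P >-> R}) : continuously_distributed X ->
  {ae P, forall w, forall t,
    (rank_transform G X w <= t) = (distr_fun X (X w) <= G t)}.
Proof.
move=> cX; apply: filterS (ae_grade_itv cX) => w U01 t.
by rewrite /rank_transform quantileP.
Qed.

Lemma measurable_sublevel Y t : measurable_fun setT Y ->
  measurable [set w | Y w <= t].
Proof.
move=> mY; rewrite -[X in measurable X]setTI.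
exact: (mY measurableT _ (measurable_ray t)).
Qed.

Lemma rank_transform_law G (X : {RV P >-> R}) : continuously_distributed X ->
  has_law (rank_transform G X) G.
Proof.
move=> cX; apply: has_law_of_cdf; first exact: measurable_rank_transform.
move=> t; rewrite -(grade_uniform cX (cumulative_itv G t)).
apply: ae_eq_measure.
- by apply: measurable_sublevel; exact: measurable_rank_transform.
- exact: measurable_grade_le.
- by apply: filterS (rank_transform_ae_le G cX) => w /= ->.
Qed.

(** The joint distribution function of the grades of [X1] and [X2]. For
    continuous margins it is, on the unit square, the copula of [(X1, X2)];
    see [grade_copula_unique]. *)
Definition grade_copula (X1 X2 : {RV P >-> R}) (u v : R) : R :=
  fine (P [set w | distr_fun X1 (X1 w) <= u /\ distr_fun X2 (X2 w) <= v]).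

(** The joint distribution function of rank transforms only depends on the
    copula. *)
Lemma rank_transform_joint G1 G2 (X1 X2 : {RV P >-> R}) s t :
  continuously_distributed X1 -> continuously_distributed X2 ->
  P ([set w | rank_transform G1 X1 w <= s] `&`
     [set w | rank_transform G2 X2 w <= t]) =
  (grade_copula X1 X2 (G1 s) (G2 t))%:E.
Proof.
move=> cX1 cX2; rewrite fineK ?fin_num_measure//; last first.
  by apply: measurableI; exact: measurable_grade_le.
apply: ae_eq_measure.
- by apply: measurableI; apply: measurable_sublevel;
    exact: measurable_rank_transform.
- by apply: measurableI; exact: measurable_grade_le.
- by apply: filterS2 (rank_transform_ae_le G1 cX1)
    (rank_transform_ae_le G2 cX2) => w /= -> ->.
Qed.

End random_variables_with_a_given_law.

(** * Approximation of the identity by step functions *)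

Section step_functions.
Context (R : realType).
Implicit Types (a delta y : R) (n M : nat).

(** A staircase with [M] steps of height [delta], descending on the interval
    from [a] to [a + M * delta], stays within [delta] of the affine function
    it discretizes and is constant outside this interval. *)
Lemma staircase a delta y M : 0 < delta ->
  let D := delta * \sum_(i < M) (y <= a + i%:R * delta)%R%:R in
  [/\ y <= a -> D = M%:R * delta,
      a + M%:R * delta <= y -> D = 0 &
      a <= y <= a + M%:R * delta -> `|D - (a + M%:R * delta - y)| <= delta].
Proof.
move=> d0; elim: M => [|M /= [IH1 IH2 IH3]] /=.
  rewrite big_ord0 !mulr0 mul0r; split => // /andP[ay].
  rewrite addr0 => ya.
  by rewrite ler_norml; apply/andP; split; lra.
rewrite big_ord_recr/= mulrDr; set D := delta * _ in IH1 IH2 IH3 *.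
have dM : 0 <= M%:R * delta by rewrite mulr_ge0// ltW.
rewrite -natr1 mulrDl mul1r; split => [ya|ya|/andP[ay ya]].
- have -> : y <= a + M%:R * delta by lra.
  by rewrite IH1// mulr1.
- have -> : (y <= a + M%:R * delta) = false.
    by apply/negbTE; rewrite -ltNge; lra.
  by rewrite mulr0 addr0 IH2//; lra.
- case: (leP y (a + M%:R * delta)) => yM /=.
    have := IH3; rewrite ay yM => /(_ isT).
    rewrite !ler_norml mulr1 => /andP[? ?].
    by apply/andP; split; lra.
  have -> : D = 0 by apply: IH2; exact: ltW.
  by rewrite mulr0 addr0 ler_norml; apply/andP; split; lra.
Qed.

(** The points from [-N] up, spaced by 1/N, where [N = n + 1]. *)
Definition grid n (i : nat) : R := - n.+1%:R + i%:R * n.+1%:R^-1.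

(** Rounding of [y] to a multiple of 1/N, truncated to [-N, N], where
    [N = n + 1]. Up to constants it is a negative combination of indicators of
    half-lines, so that its covariances only involve distribution functions. *)
Definition step n y : R :=
  n.+1%:R - n.+1%:R^-1 * \sum_(i < 2 * n.+1 * n.+1) (y <= grid n i)%R%:R.

Lemma step_error n y : `|y| <= n.+1%:R -> `|step n y - y| <= n.+1%:R^-1.
Proof.
rewrite ler_norml => /andP[y1 y2].
have N0 : 0 < n.+1%:R^-1 :> R by rewrite invr_gt0.
have [_ _] := staircase (- n.+1%:R) y (2 * n.+1 * n.+1) N0.
rewrite natrM mulfK// natrM.
rewrite (_ : - n.+1%:R + 2 * n.+1%:R = n.+1%:R); last by ring.
rewrite y1 y2 => /(_ isT); rewrite -/(step n y) distrC; congr (`|_| <= _).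
by rewrite /step; ring.
Qed.

Lemma step_error_far n y : n.+1%:R <= `|y| -> `|step n y - y| <= `|y|.
Proof.
have N0 : 0 < n.+1%:R^-1 :> R by rewrite invr_gt0.
have Np : 0 < n.+1%:R :> R by [].
have [h1 h2 _] := staircase (- n.+1%:R) y (2 * n.+1 * n.+1) N0.
move: h1 h2; rewrite natrM mulfK// natrM.
rewrite (_ : - n.+1%:R + 2 * n.+1%:R = n.+1%:R); last by ring.
rewrite /step /grid => h1 h2; case: (lerP 0 y) => y0.
  rewrite ger0_norm// => Ny; rewrite (h2 Ny) ler_norml.
  by apply/andP; split; lra.
rewrite ltr0_norm// lerNr => yN; rewrite h1// ler_norml.
by apply/andP; split; lra.
Qed.

(** An [n]-independent bound, integrable when the second moment is finite. *)
Lemma step_error_le n y : (step n y - y) ^+ 2 <= 1 + y ^+ 2.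
Proof.
have y20 : 0 <= y ^+ 2 by exact: sqr_ge0.
have [yN|/ltW Ny] := leP `|y| n.+1%:R.
  have s1 : `|step n y - y| <= 1.
    by rewrite (le_trans (step_error yN))// invf_le1// ler1n.
  have : `|step n y - y| ^+ 2 <= 1 by rewrite expr_le1.
  by rewrite -normrX ger0_norm ?sqr_ge0//; lra.
have := step_error_far Ny.
by rewrite -ler_sqr ?nnegrE// !real_normK ?num_real//; lra.
Qed.

Lemma measurable_step n : measurable_fun setT (step n).
Proof.
apply: measurable_funB => //; apply: measurable_funM => //.
apply: measurable_sum => i.
have -> : (fun y : R => (y <= grid n i)%R%:R : R) =
    \1_[set y : R | y <= grid n i].
  by apply/funext => y; rewrite indicE; congr (_%:R); congr nat_of_bool;
    apply/idP/idP; rewrite inE.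
exact: measurable_indic (measurable_ray _).
Qed.

Lemma cvg_step y : step n y @[n --> \oo] --> y.
Proof.
apply/cvgrPdist_le => e e0.
have h0 : \forall n \near \oo, n.+1%:R^-1 <= e.
  exact: cvgr_le (@cvg_harmonic R) _ e0.
near=> n; rewrite distrC (le_trans (step_error _))//; last by near: n.
rewrite (@le_trans _ _ n%:R)// ?ler_nat//; near: n; exact: nbhs_infty_ger.
Unshelve. all: by end_near. Qed.

End step_functions.

Section step_approximation.
Context (R : realType) (G : cumulativeBounded (0 : R) (1 : R)).
Hypothesis G2 : finite_second_moment_distr G.

(** The second moment of the law [G]. *)
Definition second_moment : R := fine 'E_(law G)[((fun y : R => y) ^+ 2)%R]%E.

(** The mean squared rounding error under the law [G]. *)
Definition step_mse n : R :=
  fine 'E_(law G)[((fun y : R => step n y - y) ^+ 2)%R]%E.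

Lemma L2_id : (fun y : R => y) \in Lfun (law G) 2%:E.
Proof. exact: second_moment_L2. Qed.

Lemma cvg_step_mse : step_mse n @[n --> \oo] --> 0.
Proof.
apply: fine_cvg; rewrite expectation.unlock.
have i0 : (\int[law G]_(y in setT) (cst 0) y = 0)%E by exact: integral0.
rewrite -[X in _ --> X]i0.
(* Dominated convergence, by 1 + y^2. *)
apply: (@dominated_cvg _ _ _ (law G) setT measurableT _ _
  (fun y : R => (1 + y ^+ 2)%:E)) => //.
- move=> n; apply/measurable_EFinP; rewrite expr2.
  by apply: measurable_funM; apply: measurable_funB => //;
    exact: measurable_step.
- move=> y _; apply: cvg_EFin; first exact: nearW.
  have : (step n y - y) * (step n y - y) @[n --> \oo] --> (y - y) * (y - y).
    by apply: cvgM; (apply: cvgB; [exact: cvg_step|exact: cvg_cst]).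
  by rewrite subrr mul0r.
- rewrite (_ : (fun y => _) =
    ((EFin \o cst 1%R) \+ (EFin \o (fun y : R => (y ^+ 2)%R)))%E)//.
  apply: integrableD => //; first exact: finite_measure_integrable_cst.
  exact: Lfun2_integrable_sqr L2_id.
- move=> n y _; rewrite /= lee_fin ger0_norm ?sqr_ge0//.
  exact: step_error_le.
Qed.

End step_approximation.

(** * Covariance of rank transforms as a limit of functionals of the copula *)

Section covariance_of_steps.
Context d (T : measurableType d) (R : realType) (P : probability T R).

Lemma L2_indic (A : set T) : measurable A -> (\1_A : T -> R) \in Lfun P 2%:E.
Proof.
move=> mA; apply: second_moment_L2; first exact: measurable_indic.
rewrite /finite_second_moment (_ : \1_A ^+ 2 = \1_A :> (T -> R)); last first.
  apply/funext => w; rewrite expr2 -[LHS]/(\1_A w * \1_A w) !indicE.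
  by case: (w \in A); rewrite ?mulr1 ?mulr0.
by rewrite expectation_indic// (le_lt_trans (probability_le1 P mA))// ltry.
Qed.

Lemma cov_indic (A B : set T) : measurable A -> measurable B ->
  cov P \1_A \1_B = fine (P (A `&` B)) - fine (P A) * fine (P B).
Proof.
move=> mA mB; have A2 := L2_indic mA; have B2 := L2_indic mB.
have mAB := measurableI _ _ mA mB.
have AB : (\1_A * \1_B)%R = \1_(A `&` B) :> (T -> R) by rewrite indicI.
rewrite /cov covarianceE; [|exact: L2_L1|exact: L2_L1|exact: L2_M].
rewrite AB !expectation_indic//.
by rewrite fineB ?fineM// ?fin_numM ?fin_num_measure.
Qed.

Lemma L2_sum n (F : 'I_n -> T -> R) : (forall i, F i \in Lfun P 2%:E) ->
  \sum_(i < n) F i \in Lfun P 2%:E.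
Proof.
move=> F2; apply: (big_ind (fun f => f \in Lfun P 2%:E)) => //.
- exact: Lfun_cst.
- by move=> f g; exact: L2_D.
Qed.

Lemma cov_suml n (F : 'I_n -> T -> R) Z : (forall i, F i \in Lfun P 2%:E) ->
  Z \in Lfun P 2%:E -> cov P (\sum_(i < n) F i) Z = \sum_(i < n) cov P (F i) Z.
Proof.
move=> F2 Z2.
suff [_ ->] : (\sum_(i < n) F i \in Lfun P 2%:E) /\
    cov P (\sum_(i < n) F i) Z = \sum_(i < n) cov P (F i) Z by [].
apply: (big_ind2 (fun f c => (f \in Lfun P 2%:E) /\ cov P f Z = c)) => //.
- by split; [exact: Lfun_cst|exact: cov_cst_l].
- move=> f c g c' [f2 <-] [g2 <-]; split; first exact: L2_D.
  exact: covDl.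
Qed.

Lemma step_comp n (Y : T -> R) : step n \o Y = cst n.+1%:R \-
  (n.+1%:R^-1 \o* (\sum_(i < 2 * n.+1 * n.+1) \1_[set w | Y w <= grid R n i])).
Proof.
apply/funext => w; rewrite /step /= [in RHS]mulrC; congr (_ - _ * _).
rewrite fct_sumE; apply: eq_bigr => i _; rewrite indicE.
congr (nat_of_bool _)%:R.
by apply/idP/idP; rewrite inE.
Qed.

Lemma step_L2 n (Y : T -> R) : measurable_fun setT Y ->
  step n \o Y \in Lfun P 2%:E.
Proof.
move=> mY; rewrite step_comp; apply: L2_B; first exact: Lfun_cst.
apply: L2_Z; apply: L2_sum => i; apply: L2_indic.
exact: measurable_sublevel.
Qed.

(** The covariance of the roundings of two rank transforms, as a functional of
    the joint distribution function [K] of the grades. It is nondecreasing in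
    [K] and vanishes for [K u v = u * v]. *)
Definition step_cov n (F1 F2 : R -> R) (K : R -> R -> R) : R :=
  n.+1%:R^-1 * (n.+1%:R^-1 *
    \sum_(i < 2 * n.+1 * n.+1) \sum_(j < 2 * n.+1 * n.+1)
      (K (F1 (grid R n i)) (F2 (grid R n j)) -
       F1 (grid R n i) * F2 (grid R n j))).

Lemma cov_step n (G1 G2 : cumulativeBounded (0 : R) (1 : R))
    (X1 X2 : {RV P >-> R}) :
  continuously_distributed X1 -> continuously_distributed X2 ->
  cov P (step n \o rank_transform G1 X1) (step n \o rank_transform G2 X2) =
  step_cov n G1 G2 (grade_copula X1 X2).
Proof.
move=> cX1 cX2; set Y1 := rank_transform G1 X1; set Y2 := rank_transform G2 X2.
have mY1 : measurable_fun setT Y1 by exact: measurable_rank_transform.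
have mY2 : measurable_fun setT Y2 by exact: measurable_rank_transform.
have mI1 i := L2_indic (measurable_sublevel (grid R n i) mY1).
have mI2 i := L2_indic (measurable_sublevel (grid R n i) mY2).
have cst2 (c : R) : cst c \in Lfun P 2%:E by exact: Lfun_cst.
rewrite !step_comp; set S1 := \sum_(i < _) _; set S2 := \sum_(i < _) _.
have S12 : S1 \in Lfun P 2%:E by apply: L2_sum => i; exact: mI1.
have S22 : S2 \in Lfun P 2%:E by apply: L2_sum => i; exact: mI2.
have V2 := L2_B (cst2 n.+1%:R) (L2_Z n.+1%:R^-1 S22).
rewrite covBl ?L2_Z// cov_cst_l sub0r covZl// covC covBl ?L2_Z// cov_cst_l.
rewrite sub0r covZl// mulrN opprK; congr (_ * (_ * _)).
rewrite covC cov_suml//; apply: eq_bigr => i _.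
rewrite covC cov_suml//; apply: eq_bigr => j _.
rewrite covC cov_indic;
  [|exact: measurable_sublevel|exact: measurable_sublevel].
rewrite (has_law_cdf _ (rank_transform_law G1 cX1)).
rewrite (has_law_cdf _ (rank_transform_law G2 cX2)).
by rewrite rank_transform_joint.
Qed.

End covariance_of_steps.

Section main_estimate.
Context (R : realType) (G : cumulativeBounded (0 : R) (1 : R)).
Hypothesis G2 : finite_second_moment_distr G.

(** A bound on the change of covariance caused by rounding; apart from
    [n] it depends on the law only. *)
Definition step_bound n : R :=
  2 * (Num.sqrt (step_mse G n) * Num.sqrt (second_moment G)) + step_mse G n.

Lemma cvg_step_bound : step_bound n @[n --> \oo] --> 0.
Proof.
have := cvg_step_mse G2; rewrite /step_bound => m0.
rewrite (_ : 0 = 2 * (Num.sqrt 0 * Num.sqrt (second_moment G)) + 0); last first.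
  by rewrite sqrtr0 mul0r mulr0 addr0.
apply: cvgD => //; apply: cvgMr; apply: cvgMl.
by apply: (cvg_comp _ _ m0); exact: sqrt_continuous.
Qed.

Context d (T : measurableType d) (P : probability T R).

Lemma rank_transform_L2 (X : {RV P >-> R}) : continuously_distributed X ->
  rank_transform G X \in Lfun P 2%:E.
Proof.
move=> cX; apply: second_moment_L2; first exact: measurable_rank_transform.
exact/(has_law_finite_second_moment (rank_transform_law G cX)).
Qed.

(** The covariance of rank transforms is approximated by functionals of the
    copula, uniformly over all probability spaces and pairs of random
    variables. *)
Lemma cov_step_bound n (X1 X2 : {RV P >-> R}) :
  continuously_distributed X1 -> continuously_distributed X2 ->
  `|cov P (rank_transform G X1) (rank_transform G X2) -
    step_cov n G G (grade_copula X1 X2)| <= step_bound n.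
Proof.
move=> cX1 cX2; rewrite -cov_step//.
set Y1 := rank_transform G X1; set Y2 := rank_transform G X2.
have Y12 : Y1 \in Lfun P 2%:E by exact: rank_transform_L2.
have Y22 : Y2 \in Lfun P 2%:E by exact: rank_transform_L2.
have S12 : step n \o Y1 \in Lfun P 2%:E.
  by apply: step_L2; exact: L2_measurable Y12.
have S22 : step n \o Y2 \in Lfun P 2%:E.
  by apply: step_L2; exact: L2_measurable Y22.
pose D1 := step n \o Y1 \- Y1; pose D2 := step n \o Y2 \- Y2.
have D12 : D1 \in Lfun P 2%:E by exact: L2_B.
have D22 : D2 \in Lfun P 2%:E by exact: L2_B.
have -> : cov P (step n \o Y1) (step n \o Y2) =
    cov P Y1 Y2 + (cov P D1 Y2 + cov P Y1 D2 + cov P D1 D2).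
  exact: cov_perturbation.
have var_Y (X : {RV P >-> R}) : continuously_distributed X ->
    var P (rank_transform G X) <= second_moment G.
  move=> cX; apply: le_trans (var_le_second_moment (rank_transform_L2 cX)) _.
  have /= := has_law_second_moment (rank_transform_law G cX) (f:=id).
  by rewrite /second_moment => <-.
have var_D (X : {RV P >-> R}) : continuously_distributed X ->
    var P (step n \o rank_transform G X \- rank_transform G X) <= step_mse G n.
  move=> cX.
  have Y2' := rank_transform_L2 cX.
  have S2' := step_L2 P n (L2_measurable Y2').
  apply: le_trans (var_le_second_moment (L2_B S2' Y2')) _.
  rewrite /step_mse -(has_law_second_moment (rank_transform_law G cX))//.
  by apply: measurable_funB => //; exact: measurable_step.
have bnd U V a b : U \in Lfun P 2%:E -> V \in Lfun P 2%:E ->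
    var P U <= a -> var P V <= b -> `|cov P U V| <= Num.sqrt a * Num.sqrt b.
  move=> U2 V2 Ua Vb; apply: le_trans (normr_cov_le U2 V2) _.
  have a0 := le_trans (var_ge0 P U) Ua; have b0 := le_trans (var_ge0 P V) Vb.
  by apply: ler_pM; rewrite ?sqrtr_ge0 ?ler_sqrt.
have B1 := bnd _ _ _ _ D12 Y22 (var_D _ cX1) (var_Y _ cX2).
have B2 := bnd _ _ _ _ Y12 D22 (var_Y _ cX1) (var_D _ cX2).
have B3 := bnd _ _ _ _ D12 D22 (var_D _ cX1) (var_D _ cX2).
have m0 : 0 <= step_mse G n := le_trans (var_ge0 P _) (var_D _ cX1).
rewrite -expr2 sqr_sqrtr// in B3.
rewrite opprD addrA subrr sub0r normrN.
apply: le_trans (ler_normD _ _) _; rewrite /step_bound.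
apply: lerD => //; apply: le_trans (ler_normD _ _) _.
rewrite [2 * _]mulrDl !mul1r; apply: lerD => //.
by rewrite mulrC.
Qed.

End main_estimate.

(** * The joint distribution function of the grades *)

Section probabilities.
Context d (T : measurableType d) (R : realType) (P : probability T R).
Implicit Types A B : set T.

(** Real-valued probability of an event. *)
Definition pr (A : set T) : R := fine (P A).

Lemma prE A : measurable A -> (pr A)%:E = P A.
Proof. by move=> mA; rewrite /pr fineK// fin_num_measure. Qed.

Lemma le_pr A B : measurable A -> measurable B -> A `<=` B -> pr A <= pr B.
Proof. by move=> mA mB AB; rewrite -lee_fin !prE// le_measure ?inE. Qed.

Lemma pr_setDI A B : measurable A -> measurable B ->
  pr (A `\` B) = pr A - pr (A `&` B).
Proof.
move=> mA mB; apply: EFin_inj; have mAB := measurableI _ _ mA mB.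
rewrite EFinB !prE//; last exact: measurableD.
by rewrite measureD// -ge0_fin_numE ?fin_num_measure.
Qed.

Lemma pr_setC A : measurable A -> pr (~` A) = 1 - pr A.
Proof.
move=> mA; apply: EFin_inj; rewrite EFinB !prE ?probability_setC//.
exact: measurableC.
Qed.

Lemma pr_setI_ge A B : measurable A -> measurable B ->
  pr A + pr B - 1 <= pr (A `&` B).
Proof.
move=> mA mB; have := pr_setDI mA mB; have mAB := measurableD mA mB.
have := le_pr mAB (measurableC mB) (@subIsetr _ _ _).
rewrite pr_setC//; lra.
Qed.

Lemma pr_setI_lel A B : measurable A -> measurable B -> pr (A `&` B) <= pr A.
Proof. by move=> mA mB; apply: le_pr => //; exact: measurableI. Qed.

Lemma pr_setI_ler A B : measurable A -> measurable B -> pr (A `&` B) <= pr B.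
Proof. by move=> mA mB; apply: le_pr => //; exact: measurableI. Qed.

(** For nested [A] and [A'], intersecting with [B] does not increase the
    difference of the probabilities. *)
Lemma pr_setI_comparable A A' B :
  measurable A -> measurable A' -> measurable B ->
  A `<=` A' \/ A' `<=` A ->
  `|pr (A `&` B) - pr (A' `&` B)| <= `|pr A - pr A'|.
Proof.
have sub C C' : measurable C -> measurable C' -> measurable B -> C `<=` C' ->
    `|pr (C `&` B) - pr (C' `&` B)| <= `|pr C - pr C'|.
  move=> mC mC' mB CC'.
  have mCB := measurableI _ _ mC mB; have mC'B := measurableI _ _ mC' mB.
  have h1 : pr (C `&` B) <= pr (C' `&` B) by apply: le_pr => //; exact: setSI.
  have h2 : pr C <= pr C' by exact: le_pr.
  rewrite distrC [leRHS]distrC !ger0_norm ?subr_ge0//.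
  have -> : pr C = pr (C' `&` C) by rewrite (setIidr CC').
  have -> : pr (C `&` B) = pr ((C' `&` B) `&` C).
    by rewrite setIAC (setIidr CC').
  rewrite -!pr_setDI//; apply: le_pr; try exact: measurableD.
  by move=> w [[]].
move=> mA mA' mB [AA'|A'A]; first exact: sub.
by rewrite distrC [leRHS]distrC; exact: sub.
Qed.

Lemma pr_setI_dist A A' B B' : measurable A -> measurable A' ->
  measurable B -> measurable B' ->
  A `<=` A' \/ A' `<=` A -> B `<=` B' \/ B' `<=` B ->
  `|pr (A `&` B) - pr (A' `&` B')| <= `|pr A - pr A'| + `|pr B - pr B'|.
Proof.
move=> mA mA' mB mB' AA' BB'.
rewrite (le_trans (ler_distD (pr (A' `&` B)) _ _))//; apply: lerD.
  exact: pr_setI_comparable.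
by rewrite ![A' `&` _]setIC; exact: pr_setI_comparable.
Qed.

End probabilities.

Section grade_copulas.
Context d (T : measurableType d) (R : realType) (P : probability T R).
Variables X1 X2 : {RV P >-> R}.
Hypothesis cX1 : continuously_distributed X1.
Hypothesis cX2 : continuously_distributed X2.

Lemma pr_RV_le (X : {RV P >-> R}) x : pr P [set w | X w <= x] = distr_fun X x.
Proof. by rewrite /pr -distr_funE. Qed.

Lemma pr_grade (X : {RV P >-> R}) u :
  continuously_distributed X -> 0 <= u <= 1 ->
  pr P [set w | distr_fun X (X w) <= u] = u.
Proof. by move=> cX u01; rewrite /pr grade_uniform. Qed.

(** A form of the 1-Lipschitz property of copulas: the events [{F(X) <= u}]
    and [{X <= x}] are both lower level sets of [X], hence nested. *)
Lemma grade_copula_joint u v x y : 0 <= u <= 1 -> 0 <= v <= 1 ->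
  `|grade_copula X1 X2 u v - joint_distr_fun X1 X2 x y| <=
  `|u - distr_fun X1 x| + `|v - distr_fun X2 y|.
Proof.
have cmp (X : {RV P >-> R}) t z :
    [set w | distr_fun X (X w) <= t] `<=` [set w | X w <= z] \/
    [set w | X w <= z] `<=` [set w | distr_fun X (X w) <= t].
  have [zt|tz] := leP (distr_fun X z) t; [right|left] => w /=.
    by move=> /(distr_fun_nd X)/le_trans; exact.
  move=> wt; rewrite leNgt; apply/negP => /ltW/(distr_fun_nd X).
  by apply/negP; rewrite -ltNge (le_lt_trans wt).
move=> u01 v01.
rewrite -[in `|u - _|](pr_grade cX1 u01) -[in `|v - _|](pr_grade cX2 v01).
rewrite -!pr_RV_le; apply: pr_setI_dist;
  try exact: measurable_grade_le; try exact: measurable_RV_le.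
- exact: cmp.
- exact: cmp.
Qed.

Lemma grade_copula0l v : grade_copula X1 X2 0 v = 0.
Proof.
apply/eqP; rewrite eq_le fine_ge0// andbT.
rewrite -[leRHS](@pr_grade X1 0)// ?lexx ?ler01//.
by apply: pr_setI_lel; exact: measurable_grade_le.
Qed.

Lemma grade_copula0r u : grade_copula X1 X2 u 0 = 0.
Proof.
apply/eqP; rewrite eq_le fine_ge0// andbT.
rewrite -[leRHS](@pr_grade X2 0)// ?lexx ?ler01//.
by apply: pr_setI_ler; exact: measurable_grade_le.
Qed.

Lemma grade_copula1l v : 0 <= v <= 1 -> grade_copula X1 X2 1 v = v.
Proof.
move=> v01; rewrite -[RHS](pr_grade cX2 v01); congr (fine (P _)).
apply/seteqP; split => w /=; first by case.
by split => //; case/andP : (distr_fun_itv X1 (X1 w)).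
Qed.

Lemma grade_copula1r u : 0 <= u <= 1 -> grade_copula X1 X2 u 1 = u.
Proof.
move=> u01; rewrite -[RHS](pr_grade cX1 u01); congr (fine (P _)).
apply/seteqP; split => w /=; first by case.
by split => //; case/andP : (distr_fun_itv X2 (X2 w)).
Qed.

Lemma grade_copula_level u v : 0 < u < 1 -> 0 < v < 1 ->
  exists x y, [/\ distr_fun X1 x = u, distr_fun X2 y = v &
    grade_copula X1 X2 u v = joint_distr_fun X1 X2 x y].
Proof.
move=> u01 v01.
have [x [xu _]] := distr_fun_level cX1 u01.
have [y [yv _]] := distr_fun_level cX2 v01.
exists x, y; split => //; apply/eqP; rewrite -subr_eq0 -normr_le0.
have u01' : 0 <= u <= 1 by case/andP: u01 => /ltW -> /ltW ->.
have v01' : 0 <= v <= 1 by case/andP: v01 => /ltW -> /ltW ->.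
by have := grade_copula_joint x y u01' v01'; rewrite xu yv !subrr !normr0 addr0.
Qed.

Lemma itv01_cases (u : R) : 0 <= u <= 1 -> [\/ u = 0, u = 1 | 0 < u < 1].
Proof.
move=> /andP[]; rewrite le_eqVlt => /predU1P[<-|u0]; first by constructor 1.
rewrite le_eqVlt => /predU1P[->|u1]; first by constructor 2.
by constructor 3; rewrite u0.
Qed.

(** Uniqueness in Sklar's theorem, for continuous margins. *)
Lemma grade_copula_unique C u v : copula_of X1 X2 C ->
  0 <= u <= 1 -> 0 <= v <= 1 -> grade_copula X1 X2 u v = C u v.
Proof.
move=> [[C0 C1 _] CE] u01 v01.
have [->|->|u01'] := itv01_cases u01.
- by rewrite grade_copula0l (C0 _ v01).2.
- by rewrite grade_copula1l// (C1 _ v01).2.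
have [->|->|v01'] := itv01_cases v01.
- by rewrite grade_copula0r (C0 _ u01).1.
- by rewrite grade_copula1r// (C1 _ u01).1.
by have [x [y [<- <- ->]]] := grade_copula_level u01' v01'.
Qed.

Lemma grade_copula_independent u v : independent_RV X1 X2 ->
  0 <= u <= 1 -> 0 <= v <= 1 -> grade_copula X1 X2 u v = u * v.
Proof.
move=> ind u01 v01.
have mF (X : {RV P >-> R}) t : measurable [set x | distr_fun X x <= t].
  rewrite -[X in measurable X]setTI.
  exact: (measurable_distr_fun X measurableT (measurable_ray t)).
have := ind _ _ (mF X1 u) (mF X2 v).
have -> : X1 @^-1` [set x | distr_fun X1 x <= u] =
  [set w | distr_fun X1 (X1 w) <= u] by [].
have -> : X2 @^-1` [set x | distr_fun X2 x <= v] =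
  [set w | distr_fun X2 (X2 w) <= v] by [].
by rewrite (grade_uniform cX1 u01) (grade_uniform cX2 v01) => /(congr1 fine).
Qed.

End grade_copulas.

Section grade_copula_limits.
Context (R : realType).

Lemma joint_swap d (T : measurableType d) (P : probability T R)
    (X1 X2 : {RV P >-> R}) x y :
  joint_distr_fun X1 X2 x y = joint_distr_fun X2 X1 y x.
Proof.
by rewrite /joint_distr_fun; congr (fine (P _)); apply/seteqP; split => w /= [].
Qed.

Lemma joint_margin_bounds d (T : measurableType d) (P : probability T R)
    (X1 X2 : {RV P >-> R}) x y :
  distr_fun X1 x + distr_fun X2 y - 1 <= joint_distr_fun X1 X2 x y
    <= distr_fun X1 x.
Proof.
rewrite -!pr_RV_le; apply/andP; split.
  by apply: pr_setI_ge; exact: measurable_RV_le.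
by apply: pr_setI_lel; exact: measurable_RV_le.
Qed.

(** [{X1 <= x}] is contained in [{X1 <= x, X2 <= y}] together with
    [{X2 > y}], whose probability is at most [1 - joint_distr_fun X1 X2 z y]. *)
Lemma margin_joint_le d (T : measurableType d) (P : probability T R)
    (X1 X2 : {RV P >-> R}) x y z :
  distr_fun X1 x <= joint_distr_fun X1 X2 x y + (1 - joint_distr_fun X1 X2 z y).
Proof.
have := joint_margin_bounds X2 X1 y z; rewrite joint_swap => /andP[_ zy].
have := joint_margin_bounds X1 X2 x y; lra.
Qed.

(** Convergence of joint distribution functions to a proper one implies
    convergence of the margins, although the margins are limits at infinity of
    the joint ones: no mass is lost since the limit is proper. *)
Lemma cvg_margin (d : nat -> measure_display)
    (T : forall n, measurableType (d n))
    (P : forall n, probability (T n) R) (X1 X2 : forall n, {RV (P n) >-> R})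
    (d' : measure_display) (T' : measurableType d') (P' : probability T' R)
    (X1' X2' : {RV P' >-> R}) x :
  (forall x1 x2, joint_distr_fun (X1 n) (X2 n) x1 x2 @[n --> \oo]
                   --> joint_distr_fun X1' X2' x1 x2) ->
  distr_fun (X1 n) x @[n --> \oo] --> distr_fun X1' x.
Proof.
move=> H; apply/cvgrPdist_le => e e0.
have e4 : 1 - e / 4 < 1 by lra.
(* The limit gives mass at least 1 - e/2 to {X1' <= z, X2' <= y}. *)
have [z Fz] : exists z, 1 - e / 4 <= distr_fun X1' z.
  have [M [_ h]] : \forall t \near +oo, 1 - e / 4 <= distr_fun X1' t.
    exact: cvgr_ge (distr_fun_cvgy X1') _ e4.
  by exists (M + 1); apply: h; rewrite ltrDl.
have [y Fy] : exists y, 1 - e / 4 <= distr_fun X2' y.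
  have [M [_ h]] : \forall t \near +oo, 1 - e / 4 <= distr_fun X2' t.
    exact: cvgr_ge (distr_fun_cvgy X2') _ e4.
  by exists (M + 1); apply: h; rewrite ltrDl.
have e40 : 0 < e / 4 by lra.
have /cvgrPdist_le/(_ _ e40) Hx := H x y.
have /cvgrPdist_le/(_ _ e40) Hz := H z y.
near=> n.
have : `|joint_distr_fun X1' X2' x y -
         joint_distr_fun (X1 n) (X2 n) x y| <= e / 4.
  by near: n.
have : `|joint_distr_fun X1' X2' z y -
         joint_distr_fun (X1 n) (X2 n) z y| <= e / 4.
  by near: n.
rewrite !ler_norml => /andP[a1 a2] /andP[b1 b2].
have := margin_joint_le (X1 n) (X2 n) x y z.
have /andP[c1 c2] := joint_margin_bounds (X1 n) (X2 n) x y.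
have /andP[d1 d2] := joint_margin_bounds X1' X2' x y.
have /andP[f1 f2] := joint_margin_bounds X1' X2' z y.
by move=> m; apply/andP; split; lra.
Unshelve. all: by end_near. Qed.

Lemma cvg_grade_copula (d : nat -> measure_display)
    (T : forall n, measurableType (d n))
    (P : forall n, probability (T n) R) (X1 X2 : forall n, {RV (P n) >-> R})
    (d' : measure_display) (T' : measurableType d') (P' : probability T' R)
    (X1' X2' : {RV P' >-> R}) u v :
  (forall n, continuously_distributed (X1 n)) ->
  (forall n, continuously_distributed (X2 n)) ->
  continuously_distributed X1' -> continuously_distributed X2' ->
  (forall x1 x2, joint_distr_fun (X1 n) (X2 n) x1 x2 @[n --> \oo]
                   --> joint_distr_fun X1' X2' x1 x2) ->
  0 <= u <= 1 -> 0 <= v <= 1 ->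
  grade_copula (X1 n) (X2 n) u v @[n --> \oo] --> grade_copula X1' X2' u v.
Proof.
move=> cX1 cX2 cX1' cX2' H u01 v01.
have cstE (F : nat -> R) c : (forall n, F n = c) -> F n @[n --> \oo] --> c.
  by move=> Fc; rewrite (_ : F = cst c); [exact: cvg_cst|exact/funext].
have [u0|u1|u01'] := itv01_cases u01.
- by rewrite u0 grade_copula0l//; apply: cstE => n; rewrite grade_copula0l.
- by rewrite u1 grade_copula1l//; apply: cstE => n; rewrite grade_copula1l.
have [v0|v1|v01'] := itv01_cases v01.
- by rewrite v0 grade_copula0r//; apply: cstE => n; rewrite grade_copula0r.
- by rewrite v1 grade_copula1r//; apply: cstE => n; rewrite grade_copula1r.
(* At a point (x, y) of levels (u, v) for the limit, both grade copulas are
   close to the joint distribution functions. *)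
have [x [y [xu yv ->]]] := grade_copula_level cX1' cX2' u01' v01'.
have F1 : distr_fun (X1 n) x @[n --> \oo] --> u.
  by rewrite -xu; exact: cvg_margin H.
have F2 : distr_fun (X2 n) y @[n --> \oo] --> v.
  rewrite -yv; apply: (@cvg_margin d T P X2 X1) => x1 x2.
  rewrite joint_swap; under eq_fun do rewrite joint_swap; exact: H.
apply/cvgrPdist_le => e e0; have e3 : 0 < e / 3 by lra.
have /cvgrPdist_le/(_ _ e3) Hxy := H x y.
move/cvgrPdist_le/(_ _ e3) : F1 => F1; move/cvgrPdist_le/(_ _ e3) : F2 => F2.
near=> n.
have a1 : `|u - distr_fun (X1 n) x| <= e / 3 by near: n.
have a2 : `|v - distr_fun (X2 n) y| <= e / 3 by near: n.
have a3 : `|joint_distr_fun X1' X2' x y -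
            joint_distr_fun (X1 n) (X2 n) x y| <= e / 3.
  by near: n.
have := grade_copula_joint (cX1 n) (cX2 n) x y u01 v01; rewrite distrC => a4.
apply: le_trans (ler_distD (joint_distr_fun (X1 n) (X2 n) x y) _ _) _; lra.
Unshelve. all: by end_near. Qed.

End grade_copula_limits.

(** * Order, independence, continuity and reflection *)

Section opposite.
Context d (T : measurableType d) (R : realType) (P : probability T R).
Variable X : {RV P >-> R}.
Hypothesis cX : continuously_distributed X.

(** Continuity is needed here: without it the left limit at [- x] would
    appear. *)
Lemma distr_fun_opp x : distr_fun (opp_RV X) x = 1 - distr_fun X (- x).
Proof.
have mle := measurable_RV_le X (- x).
have mlt : measurable [set w | X w < - x].
  have := measurable_funPTI X (measurable_itv `]-oo, (- x)[).
  by rewrite set_itvE.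
have -> : distr_fun (opp_RV X) x = pr P (~` [set w | X w < - x]).
  rewrite -pr_RV_le; congr (pr P _); apply/seteqP; split => w /=.
    by move=> h; apply/negP; rewrite -leNgt lerNl.
  by move=> /negP; rewrite -leNgt lerNl.
rewrite pr_setC// -pr_RV_le; congr (1 - _).
apply/eqP; rewrite eq_le le_pr//=; last by move=> w /= /ltW.
rewrite pr_RV_le.
have : distr_fun X y @[y --> (- x)^'-] --> distr_fun X (- x).
  by apply: cvg_at_left_filter; exact: cX.
move=> /cvgr_to_le; apply; near=> y.
rewrite -pr_RV_le; apply: le_pr => //; first exact: measurable_RV_le.
move=> w /= /le_lt_trans; apply; near: y; exact: nbhs_left_lt.
Unshelve. all: by end_near. Qed.

Lemma opp_continuously_distributed : continuously_distributed (opp_RV X).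
Proof.
rewrite /continuously_distributed.
rewrite (_ : distr_fun (opp_RV X) =
  (fun x => 1 - distr_fun X (- x))); last first.
  by apply/funext => x; rewrite distr_fun_opp.
move=> x; apply: cvgB; first exact: cvg_cst.
apply: (@cvg_comp _ _ _ (fun x : R => - x) (distr_fun X)); last exact: cX.
exact: opp_continuous.
Qed.

Lemma grade_opp w : distr_fun (opp_RV X) (opp_RV X w) = 1 - distr_fun X (X w).
Proof. by rewrite distr_fun_opp /= opprK. Qed.

(** The pair [(X, X)] is comonotone. *)
Lemma grade_copula_self u v : 0 <= u <= 1 -> 0 <= v <= 1 ->
  grade_copula X X u v = Num.min u v.
Proof.
move=> u01 v01.
have uv01 : 0 <= Num.min u v <= 1.
  by rewrite le_min ge_min; case/andP : u01 => -> ->; case/andP : v01 => -> _.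
rewrite -[RHS](pr_grade cX uv01); congr (fine (P _)).
by apply/seteqP; split => w /=; rewrite le_min => /andP.
Qed.

(** The pair [(X, - X)] is countermonotone. *)
Lemma grade_copula_opp u v : 0 <= u <= 1 -> 0 <= v <= 1 ->
  grade_copula X (opp_RV X) u v = Num.max (u + v - 1) 0.
Proof.
move=> u01 v01.
have mu := measurable_grade_le X u; have mv := measurable_grade_le (opp_RV X) v.
have pu := pr_grade cX u01.
have pv := pr_grade opp_continuously_distributed v01.
have gcE : grade_copula X (opp_RV X) u v =
  pr P ([set w | distr_fun X (X w) <= u] `&`
        [set w | distr_fun (opp_RV X) (opp_RV X w) <= v]) by [].
(* If u + v >= 1 the two events cover the space, otherwise they are disjoint. *)
have [uv|uv] := leP 0 (u + v - 1).
  have := pr_setDI P mu mv.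
  have -> : [set w | distr_fun X (X w) <= u] `\`
      [set w | distr_fun (opp_RV X) (opp_RV X w) <= v] =
      ~` [set w | distr_fun (opp_RV X) (opp_RV X w) <= v].
    apply/seteqP; split => w /=; first by case.
    move=> h; split => //; move: h => /negP; rewrite grade_opp -ltNge; lra.
  by rewrite pr_setC// pu pv -gcE; lra.
rewrite gcE (_ : _ `&` _ = set0); first by rewrite /pr measure0.
apply/seteqP; split => w //= []; rewrite grade_opp; lra.
Qed.

End opposite.

(** Comparison of two numbers through approximations with a common error. *)
Lemma le_of_approx (R : realType) (a a' : R) (b q q' : nat -> R) :
  (forall n, `|a - q n| <= b n) -> (forall n, `|a' - q' n| <= b n) ->
  b n @[n --> \oo] --> 0 -> (forall n, q n <= q' n) -> a <= a'.
Proof.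
move=> aq aq' b0 qq'; apply/ler_addgt0Pr => e e0.
have e2 : 0 < e / 2 by lra.
have [N _ /(_ N (leqnn N)) /= bN] : \forall n \near \oo, b n <= e / 2.
  exact: cvgr_le b0 _ e2.
have := aq N; have := aq' N; rewrite !ler_norml => /andP[? ?] /andP[? ?].
by have := qq' N; lra.
Qed.

Lemma cvg_sum_ord (R : realType) m (f : 'I_m -> nat -> R) (l : 'I_m -> R) :
  (forall i, f i n @[n --> \oo] --> l i) ->
  \sum_(i < m) f i n @[n --> \oo] --> \sum_(i < m) l i.
Proof.
move=> fl; elim: (index_enum _) => [|i s IH].
  by under eq_fun do rewrite big_nil; rewrite big_nil; exact: cvg_cst.
by under eq_fun do rewrite big_cons; rewrite big_cons; exact: cvgD.
Qed.

Section covariance_comparison.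
Context (R : realType) (G : cumulativeBounded (0 : R) (1 : R)).
Hypothesis G2 : finite_second_moment_distr G.

Lemma le_step_cov n (K K' : R -> R -> R) :
  (forall u v, 0 <= u <= 1 -> 0 <= v <= 1 -> K u v <= K' u v) ->
  step_cov n G G K <= step_cov n G G K'.
Proof.
move=> KK'; rewrite /step_cov !ler_pM2l ?invr_gt0//.
by do 2 (apply: ler_sum => ? _); rewrite lerD2r KK'// cumulative_itv.
Qed.

Lemma le_cov_of_grade_copula d (T : measurableType d) (P : probability T R)
    (X1 X2 : {RV P >-> R}) d' (T' : measurableType d') (P' : probability T' R)
    (X1' X2' : {RV P' >-> R}) :
  continuously_distributed X1 -> continuously_distributed X2 ->
  continuously_distributed X1' -> continuously_distributed X2' ->
  (forall u v, 0 <= u <= 1 -> 0 <= v <= 1 ->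
     grade_copula X1 X2 u v <= grade_copula X1' X2' u v) ->
  cov P (rank_transform G X1) (rank_transform G X2) <=
  cov P' (rank_transform G X1') (rank_transform G X2').
Proof.
move=> cX1 cX2 cX1' cX2' KK'.
apply: (le_of_approx (fun n => cov_step_bound G2 n cX1 cX2)
  (fun n => cov_step_bound G2 n cX1' cX2') (cvg_step_bound G2)) => n.
exact: le_step_cov.
Qed.

Lemma cov_independent d (T : measurableType d) (P : probability T R)
    (X1 X2 : {RV P >-> R}) :
  continuously_distributed X1 -> continuously_distributed X2 ->
  independent_RV X1 X2 ->
  cov P (rank_transform G X1) (rank_transform G X2) = 0.
Proof.
move=> cX1 cX2 ind.
have q0 n : step_cov n G G (grade_copula X1 X2) = 0.
  rewrite /step_cov big1 ?mulr0// => i _; rewrite big1// => j _.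
  by rewrite grade_copula_independent// ?subrr// cumulative_itv.
have b0 n : `|0 - step_cov n G G (grade_copula X1 X2)| <= step_bound G n.
  by rewrite q0 subrr normr0 (le_trans _ (cov_step_bound G2 n cX1 cX2)).
apply/eqP; rewrite eq_le; apply/andP; split.
- exact: (le_of_approx (fun n => cov_step_bound G2 n cX1 cX2) b0
    (cvg_step_bound G2)).
- exact: (le_of_approx b0 (fun n => cov_step_bound G2 n cX1 cX2)
    (cvg_step_bound G2)).
Qed.

Lemma cvg_cov (d : nat -> measure_display)
    (T : forall n, measurableType (d n))
    (P : forall n, probability (T n) R) (X1 X2 : forall n, {RV (P n) >-> R})
    (d' : measure_display) (T' : measurableType d') (P' : probability T' R)
    (X1' X2' : {RV P' >-> R}) :
  (forall n, continuously_distributed (X1 n)) ->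
  (forall n, continuously_distributed (X2 n)) ->
  continuously_distributed X1' -> continuously_distributed X2' ->
  (forall x1 x2, joint_distr_fun (X1 n) (X2 n) x1 x2 @[n --> \oo]
                   --> joint_distr_fun X1' X2' x1 x2) ->
  cov (P n) (rank_transform G (X1 n)) (rank_transform G (X2 n)) @[n --> \oo] -->
  cov P' (rank_transform G X1') (rank_transform G X2').
Proof.
move=> cX1 cX2 cX1' cX2' H; apply/cvgrPdist_le => e e0.
have e3 : 0 < e / 3 by lra.
have [N _ /(_ N (leqnn N)) /= bN] :
    \forall n \near \oo, step_bound G n <= e / 3.
  exact: cvgr_le (cvg_step_bound G2) _ e3.
have qN : step_cov N G G (grade_copula (X1 n) (X2 n)) @[n --> \oo] -->
    step_cov N G G (grade_copula X1' X2').
  rewrite /step_cov; apply: cvgMr; apply: cvgMr.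
  apply: cvg_sum_ord => i; apply: cvg_sum_ord => j.
  apply: cvgB; last exact: cvg_cst.
  by apply: cvg_grade_copula => //; exact: cumulative_itv.
move/cvgrPdist_le/(_ _ e3) : qN => qN; near=> n.
have a1 := le_trans (cov_step_bound G2 N cX1' cX2') bN.
have a2 := le_trans (cov_step_bound G2 N (cX1 n) (cX2 n)) bN.
have a3 : `|step_cov N G G (grade_copula X1' X2') -
    step_cov N G G (grade_copula (X1 n) (X2 n))| <= e / 3 by near: n.
move: a1 a2 a3; rewrite !ler_norml => /andP[? ?] /andP[? ?] /andP[? ?].
by apply/andP; split; lra.
Unshelve. all: by end_near. Qed.

End covariance_comparison.

Section reflection.
Context (R : realType) (G : cumulativeBounded (0 : R) (1 : R)) (m : R).
Hypothesis G2 : finite_second_moment_distr G.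
Hypothesis Gm : forall A : set R, measurable A ->
    pushforward (law G) (fun y : R => y - m) A =
    pushforward (law G) (fun y : R => m - y) A.
Context d (T : measurableType d) (P : probability T R) (X : {RV P >-> R}).
Hypothesis cX : continuously_distributed X.

(** The law [G] is invariant under reflection about [m]. *)
Lemma reflect_has_law d0 (T0 : measurableType d0) (P0 : probability T0 R)
    (Y : T0 -> R) :
  has_law P0 Y G -> has_law P0 (fun w => 2 * m - Y w) G.
Proof.
move=> [mY YG]; split; first exact: measurable_funB.
move=> A mA.
have mf : measurable_fun setT (fun y : R => y + m) by exact: measurable_funD.
have mg : measurable_fun setT (fun y : R => 2 * m - y).
  exact: measurable_funB.
have m1 : measurable ((fun y : R => y + m) @^-1` A).
  by rewrite -[X in measurable X]setTI; exact: mf.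
have m2 : measurable ((fun y : R => 2 * m - y) @^-1` A).
  by rewrite -[X in measurable X]setTI; exact: mg.
rewrite -[LHS]/(P0 (Y @^-1` ((fun y : R => 2 * m - y) @^-1` A))) YG//.
have := Gm m1; rewrite /pushforward /= => h.
transitivity
  (law G ((fun y : R => m - y) @^-1` ((fun y : R => y + m) @^-1` A))).
  congr (law G _); have e y : m - y + m = 2 * m - y by ring.
  by apply/seteqP; split => y /=; rewrite e.
apply: etrans (esym h) _; congr (law G _).
by apply/seteqP; split => y /=; rewrite subrK.
Qed.

(** One half of [q(1 - u) = 2 m - q(u)] holds for every [u] in ]0, 1[, while the
    reverse inequality may fail at the jumps of [q]. *)
Lemma rank_transform_opp_le w : 0 < distr_fun X (X w) < 1 ->
  rank_transform G (opp_RV X) w <= 2 * m - rank_transform G X w.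
Proof.
move=> /andP[u0 u1]; have YG := rank_transform_law G cX.
have mYG := reflect_has_law YG.
rewrite /rank_transform grade_opp//.
set p := distr_fun X (X w) in u0 u1 *; set q := quantile G p.
rewrite quantileP; last by apply/andP; split; lra.
rewrite -lee_fin -(has_law_cdf _ mYG).
have mle := measurable_grade_le X p.
have -> : (1 - p)%:E = P (~` [set w | distr_fun X (X w) <= p]).
  by rewrite probability_setC// grade_uniform// distr_fun_itv.
(* The mass G (2 m - q) = P (2 m - Y <= 2 m - q) of {q <= Y} is at least that
   of {p < U}, as Y = q(U) and quantile functions are nondecreasing. *)
apply: ae_le_measure.
- exact: measurableC.
- by apply: measurable_sublevel; case: mYG.
apply: filterS (ae_grade_itv cX) => w' u'01 /= /negP; rewrite -ltNge => pw'.
rewrite lerD2l lerN2 quantileP ?u0 ?u1//.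
by rewrite (le_trans (ltW pw'))// -quantileP.
Qed.

(** Both sides have law [G], hence the same expectation; being ordered, they
    are almost surely equal. *)
Lemma rank_transform_opp : {ae P, forall w,
  rank_transform G (opp_RV X) w = 2 * m - rank_transform G X w}.
Proof.
have YG := rank_transform_law G cX.
have mYG := reflect_has_law YG.
have ZG := rank_transform_law G (opp_continuously_distributed cX).
set Z := rank_transform G (opp_RV X) in ZG *.
set Z' := (fun w => 2 * m - rank_transform G X w) in mYG *.
have ZZ' : {ae P, forall w, Z w <= Z' w}.
  by apply: filterS (ae_grade_itv cX) => w; exact: rank_transform_opp_le.
have L2Z : Z \in Lfun P 2%:E.
  exact: (rank_transform_L2 G2 (opp_continuously_distributed cX)).
have L2Z' : Z' \in Lfun P 2%:E.
  apply: second_moment_L2; first by case: mYG.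
  exact/(has_law_finite_second_moment mYG).
have L1D := L2_L1 (L2_B L2Z' L2Z).
have i0 : (\int[P]_w `|(Z' w - Z w)%:E| = 0)%E.
  transitivity ('E_P[Z' \- Z])%E; last first.
    rewrite expectationB ?L2_L1//.
    rewrite (has_law_expectation mYG) (has_law_expectation ZG) subee//.
    by rewrite -(has_law_expectation ZG) expectation_fin_num// L2_L1.
  rewrite expectation.unlock; apply: ae_eq_integral => //.
  - apply: measurableT_comp => //; apply/measurable_EFinP.
    exact: L2_measurable (L2_B L2Z' L2Z).
  - apply/measurable_EFinP; exact: L2_measurable (L2_B L2Z' L2Z).
  by apply: filterS ZZ' => w ZZ' _; rewrite gee0_abs// lee_fin subr_ge0.
have mD : measurable_fun setT (fun w => (Z' w - Z w)%:E).
  by apply/measurable_EFinP; exact: L2_measurable (L2_B L2Z' L2Z).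
have [/(_ i0) + _] := ae_eq_integral_abs P measurableT mD.
apply: filterS => w /(_ I) [] /eqP; rewrite subr_eq0 => /eqP Zw.
exact: esym Zw.
Qed.

End reflection.

(** * Symmetric distributions yield measures of concordance *)

Lemma cov_affine d (T : measurableType d) (R : realType) (P : probability T R)
    (X Y : T -> R) (a b c e : R) : X \in Lfun P 2%:E -> Y \in Lfun P 2%:E ->
  cov P (fun w => a * X w + b) (fun w => c * Y w + e) = a * c * cov P X Y.
Proof.
have affl U V s t : U \in Lfun P 2%:E -> V \in Lfun P 2%:E ->
    cov P (fun w => s * U w + t) V = s * cov P U V.
  move=> U2 V2.
  have -> : (fun w => s * U w + t) = (s \o* U) \+ cst t.
    by apply/funext => w /=; rewrite mulrC.
  by rewrite covDl ?L2_Z ?Lfun_cst// covZl// cov_cst_l addr0.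
move=> X2 Y2.
have Y2' : (fun w => c * Y w + e) \in Lfun P 2%:E.
  have -> : (fun w => c * Y w + e) = (c \o* Y) \+ cst e.
    by apply/funext => w /=; rewrite mulrC.
  by rewrite L2_D ?L2_Z ?Lfun_cst.
by rewrite affl// covC affl// covC mulrA.
Qed.

Section same_type_reduction.
Context (R : realType) (G G' : cumulativeBounded (0 : R) (1 : R)) (c m : R).
Hypothesis c0 : 0 < c.
Hypothesis GG' : forall A : set R, measurable A ->
  law G' A = pushforward (law G) (fun y : R => c * y + m) A.

Lemma affine_has_law : has_law (law G) (fun y : R => c * y + m) G'.
Proof.
split; first by apply: measurable_funD => //; exact: measurable_funM.
by move=> A mA; rewrite GG'.
Qed.

Lemma affine_cumulative x : G' x = G ((x - m) / c).
Proof.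
apply: EFin_inj; rewrite -(has_law_cdf _ affine_has_law) -law_itv.
congr (law G _); apply/seteqP; split => y /=.
  by rewrite ler_pdivlMr// lerBrDr mulrC.
by rewrite ler_pdivlMr// lerBrDr mulrC.
Qed.

Lemma affine_quantile p : 0 < p < 1 -> quantile G' p = c * quantile G p + m.
Proof.
move=> p01.
have qE x : (quantile G' p <= x) = (c * quantile G p + m <= x).
  rewrite quantileP// affine_cumulative -quantileP//.
  by rewrite ler_pdivlMr// lerBrDr mulrC.
by apply/eqP; rewrite eq_le qE lexx -qE lexx.
Qed.

Lemma affine_finite_second_moment :
  finite_second_moment_distr G -> finite_second_moment_distr G'.
Proof.
move=> G2; apply/(has_law_finite_second_moment affine_has_law).
have -> : (fun y : R => c * y + m) = (c \o* (fun y : R => y)) \+ cst m.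
  by apply/funext => w /=; rewrite mulrC.
rewrite /finite_second_moment.
rewrite -ge0_fin_numE ?L2_sqr_fin_num ?L2_D ?L2_Z ?Lfun_cst ?L2_id//.
by apply: expectation_ge0 => y; exact: sqr_ge0.
Qed.

Lemma affine_non_degenerate : non_degenerate_distr G -> non_degenerate_distr G'.
Proof.
move=> Gnd; apply/(has_law_non_degenerate affine_has_law) => e h.
apply: (Gnd ((e - m) / c)); apply: filterS h => y <-.
by rewrite addrK mulrC mulKf// gt_eqF.
Qed.

Lemma affine_rank_transform d (T : measurableType d) (P : probability T R)
    (X : {RV P >-> R}) : continuously_distributed X ->
  {ae P, forall w, rank_transform G' X w = c * rank_transform G X w + m}.
Proof.
move=> cX; apply: filterS (ae_grade_itv cX) => w U01.
by rewrite /rank_transform affine_quantile.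
Qed.

End same_type_reduction.

(** The variance of the law [G]. *)
Definition law_var (R : realType) (G : cumulativeBounded (0 : R) (1 : R)) : R :=
  var (law G) (fun y : R => y).

Lemma law_var_gt0 (R : realType) (G : cumulativeBounded (0 : R) (1 : R)) :
  non_degenerate_distr G -> finite_second_moment_distr G -> 0 < law_var G.
Proof.
move=> Gnd G2; rewrite lt_neqAle var_ge0 andbT eq_sym; apply/eqP => v0.
exact: Gnd _ (var0_ae_cst (L2_id G2) v0).
Qed.

Lemma var_has_law d (T : measurableType d) (R : realType) (P : probability T R)
  (Y : T -> R) (G : cumulativeBounded (0 : R) (1 : R)) :
  has_law P Y G -> var P Y = law_var G.
Proof. by move=> YG; rewrite /var (has_law_variance YG). Qed.

Section symmetric_distributions.
Context (R : realType) (G G1 G2 : cumulativeBounded (0 : R) (1 : R)).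
Hypothesis Gnd : non_degenerate_distr G.
Hypothesis Gsym : symmetric_distr G.
Hypothesis GL2 : finite_second_moment_distr G.
Hypothesis GG1 : same_type G G1.
Hypothesis GG2 : same_type G G2.

(** Location and scale cancel in the correlation coefficient, so two
    distributions of the type of [G] may be replaced by [G]. *)
Lemma pearson_rank_transform d (T : measurableType d) (P : probability T R)
    (X1 X2 : {RV P >-> R}) :
  continuously_distributed X1 -> continuously_distributed X2 ->
  pearson P (rank_transform G1 X1) (rank_transform G2 X2) =
  cov P (rank_transform G X1) (rank_transform G X2) / law_var G.
Proof.
move=> cX1 cX2; have [c1 [m1 [c10 L1]]] := GG1; have [c2 [m2 [c20 L2]]] := GG2.
have v0 := law_var_gt0 Gnd GL2.
have R1 := affine_rank_transform c10 L1 cX1.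
have R2 := affine_rank_transform c20 L2 cX2.
have Y12 := rank_transform_L2 GL2 cX1; have Y22 := rank_transform_L2 GL2 cX2.
have mR (H : cumulativeBounded (0 : R) (1 : R)) X :=
  @measurable_rank_transform _ _ _ P H X.
have mA c m (X : {RV P >-> R}) :
    measurable_fun setT (fun w => c * rank_transform G X w + m).
  by apply: measurable_funD => //; apply: measurable_funM.
rewrite /pearson /variance.
rewrite (ae_eq_cov (mR _ _) (mA c1 m1 X1) (mR _ _) (mA c2 m2 X2) R1 R2).
rewrite (ae_eq_cov (mR _ _) (mA c1 m1 X1) (mR _ _) (mA c1 m1 X1) R1 R1).
rewrite (ae_eq_cov (mR _ _) (mA c2 m2 X2) (mR _ _) (mA c2 m2 X2) R2 R2).
rewrite -!/(cov P _ _) !cov_affine//.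
have varE (X : {RV P >-> R}) : continuously_distributed X ->
    cov P (rank_transform G X) (rank_transform G X) = law_var G.
  by move=> cX; exact: (var_has_law (rank_transform_law G cX)).
have sqrtE c : 0 < c -> Num.sqrt (c * c * law_var G) = c * Num.sqrt (law_var G).
  by move=> c0; rewrite -expr2 (sqrtrM _ (sqr_ge0 c)) sqrtr_sqr gtr0_norm.
rewrite !varE// !sqrtE//.
rewrite [X in _ / X = _](_ : _ = c1 * c2 * law_var G); last first.
  by rewrite mulrACA -expr2 sqr_sqrtr// ltW.
by rewrite -mulf_div divff ?mul1r// mulf_neq0// gt_eqF.
Qed.

Lemma same_type_measure_of_concordance :
  measure_of_concordance (transformed_rank_corr G1 G2).
Proof.
have v0 := law_var_gt0 Gnd GL2.
have [c1 [m1 [c10 L1]]] := GG1; have [c2 [m2 [c20 L2]]] := GG2.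
have [m Gm] := Gsym.
have sign d (T : measurableType d) (P : probability T R)
    (X1 X2 : {RV P >-> R}) :
    continuously_distributed X1 -> continuously_distributed X2 ->
    cov P (rank_transform G X1) (rank_transform G (opp_RV X2)) =
    - cov P (rank_transform G X1) (rank_transform G X2).
  move=> cX1 cX2; have cX2' := opp_continuously_distributed cX2.
  have Y12 := rank_transform_L2 GL2 cX1; have Y22 := rank_transform_L2 GL2 cX2.
  have mR X := @measurable_rank_transform _ _ _ P G X.
  have mA : measurable_fun setT (fun w => -1 * rank_transform G X2 w + 2 * m).
    by apply: measurable_funD => //; apply: measurable_funM.
  have ee : {ae P, forall w, rank_transform G (opp_RV X2) w =
      -1 * rank_transform G X2 w + 2 * m}.
    by apply: filterS (rank_transform_opp GL2 Gm cX2) => w ->; ring.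
  rewrite {1}/cov (ae_eq_cov (mR _) (mR X1) (mR _) mA _ ee); last exact: aeW.
  rewrite -/(cov P _ _) covC.
  have := @cov_affine _ _ _ P _ _ (-1) (2 * m) 1 0 Y22 Y12.
  under [X in cov P _ X = _]eq_fun do rewrite mul1r addr0.
  by move=> ->; rewrite mulN1r mulNr mul1r covC.
have self d (T : measurableType d) (P : probability T R) (X : {RV P >-> R}) :
    continuously_distributed X ->
    cov P (rank_transform G X) (rank_transform G X) = law_var G.
  by move=> cX; exact: (var_has_law (rank_transform_law G cX)).
split => /=.
- move=> d T P X1 X2 cX1 cX2; split.
  + apply/(has_law_non_degenerate (rank_transform_law G1 cX1)).
    exact: affine_non_degenerate c10 L1 Gnd.
  + apply/(has_law_finite_second_moment (rank_transform_law G1 cX1)).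
    exact: affine_finite_second_moment L1 GL2.
  + apply/(has_law_non_degenerate (rank_transform_law G2 cX2)).
    exact: affine_non_degenerate c20 L2 Gnd.
  + apply/(has_law_finite_second_moment (rank_transform_law G2 cX2)).
    exact: affine_finite_second_moment L2 GL2.
- move=> d T P X1 X2 cX1 cX2.
  by rewrite !pearson_rank_transform// covC.
- move=> d T P X1 X2 d' T' P' X1' X2' C C' cX1 cX2 cX1' cX2' XC XC' CC'.
  rewrite !pearson_rank_transform// ler_pM2r ?invr_gt0//.
  apply: le_cov_of_grade_copula => // u v u01 v01.
  rewrite (grade_copula_unique cX1 cX2 XC)//.
  by rewrite (grade_copula_unique cX1' cX2' XC')// CC'.
- move=> d T P X1 X2 cX1 cX2; rewrite pearson_rank_transform//.
  have Y12 := rank_transform_L2 GL2 cX1; have Y22 := rank_transform_L2 GL2 cX2.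
  have cX1' := opp_continuously_distributed cX1.
  have eq_cov (X X' Z Z' : {RV P >-> R}) :
      continuously_distributed X -> continuously_distributed X' ->
      continuously_distributed Z -> continuously_distributed Z' ->
      (forall u v, 0 <= u <= 1 -> 0 <= v <= 1 ->
        grade_copula X X' u v = grade_copula Z Z' u v) ->
      cov P (rank_transform G X) (rank_transform G X') =
      cov P (rank_transform G Z) (rank_transform G Z').
    move=> cX cX' cZ cZ' e; apply/eqP; rewrite eq_le; apply/andP.
    by split; apply: le_cov_of_grade_copula => // u v u01 v01; rewrite e.
  split.
  + have := normr_cov_le Y12 Y22.
    rewrite !(var_has_law (rank_transform_law G _))//.
    rewrite -expr2 sqr_sqrtr ?(ltW v0)//.
    by rewrite -ler_norml normrM normfV (gtr0_norm v0) ler_pdivrMr// mul1r.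
  + move=> XC.
    have e u v : 0 <= u <= 1 -> 0 <= v <= 1 ->
        grade_copula X1 X2 u v = grade_copula X1 X1 u v.
      move=> u01 v01; rewrite (grade_copula_unique cX1 cX2 XC)//.
      by rewrite grade_copula_self.
    rewrite (eq_cov _ _ _ _ cX1 cX2 cX1 cX1 e) (self _ _ _ _ cX1).
    by rewrite divff// gt_eqF.
  + move=> XC.
    have e u v : 0 <= u <= 1 -> 0 <= v <= 1 ->
        grade_copula X1 X2 u v = grade_copula X1 (opp_RV X1) u v.
      move=> u01 v01; rewrite (grade_copula_unique cX1 cX2 XC)//.
      by rewrite grade_copula_opp.
    rewrite (eq_cov _ _ _ _ cX1 cX2 cX1 cX1' e) (sign _ _ _ _ _ cX1 cX1).
    by rewrite (self _ _ _ _ cX1) mulNr divff// gt_eqF.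
- move=> d T P X1 X2 cX1 cX2 ind.
  by rewrite pearson_rank_transform// cov_independent// mul0r.
- move=> d T P X1 X2 cX1 cX2; have cX2' := opp_continuously_distributed cX2.
  by rewrite !pearson_rank_transform// sign// mulNr.
- move=> d T P X1 X2 d' T' P' X1' X2' cX1 cX2 cX1' cX2' H.
  rewrite pearson_rank_transform//.
  under eq_fun do rewrite pearson_rank_transform//.
  by apply: cvgMl; exact: cvg_cov.
Qed.

End symmetric_distributions.

(** * Measures of concordance come from symmetric distributions *)

Section uniform_distribution_function.
Context (R : realType).

(** The distribution function of the uniform law on [0, 1], that is [x]
    truncated to [0, 1], in a form whose continuity is plain. *)
Definition unif_cdf (x : R) : R := (`|x| - `|x - 1| + 1) / 2.

Lemma unif_cdf_le0 x : x <= 0 -> unif_cdf x = 0.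
Proof. by move=> x0; rewrite /unif_cdf !ler0_norm; lra. Qed.

Lemma unif_cdf_ge1 x : 1 <= x -> unif_cdf x = 1.
Proof. by move=> x1; rewrite /unif_cdf !ger0_norm; lra. Qed.

Lemma unif_cdf_continuous : continuous unif_cdf.
Proof.
move=> x; apply: cvgMl; apply: cvgD; last exact: cvg_cst.
apply: cvgB; apply: cvg_norm; first exact: cvg_id.
by apply: cvgB; [exact: cvg_id|exact: cvg_cst].
Qed.

Lemma unif_cdf_nd : nondecreasing unif_cdf.
Proof.
move=> x y xy; rewrite /unif_cdf ler_pM2r ?invr_gt0// lerD2r.
by case: (ger0P x); case: (ger0P y); case: (ger0P (x - 1));
  case: (ger0P (y - 1)) => *; lra.
Qed.

Lemma unif_cdf_rc : right_continuous unif_cdf.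
Proof. by move=> x; apply: cvg_at_right_filter; exact: unif_cdf_continuous. Qed.

Lemma unif_cdfNy : unif_cdf @ -oo --> (0 : R).
Proof.
apply: cvg_near_cst.
by near=> x; rewrite unif_cdf_le0//; near: x; exact: nbhs_ninfty_le.
Unshelve. all: by end_near. Qed.

Lemma unif_cdfy : unif_cdf @ +oo --> (1 : R).
Proof.
apply: cvg_near_cst.
by near=> x; rewrite unif_cdf_ge1//; near: x; exact: nbhs_pinfty_ge.
Unshelve. all: by end_near. Qed.

HB.instance Definition _ :=
  isCumulative.Build R _ R unif_cdf unif_cdf_nd unif_cdf_rc.
HB.instance Definition _ :=
  isCumulativeBounded.Build R 0 1 unif_cdf unif_cdfNy unif_cdfy.

Let unif : probability (measurableTypeR R) R := law unif_cdf.

(** The identity under the uniform law. *)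
Lemma continuous_RV_exists :
  exists X : {RV unif >-> R}, continuously_distributed X.
Proof.
pose mX := @isMeasurableFun.Build _ _ (measurableTypeR R) R idfun
  (@measurable_id _ _ setT).
pose X : {RV unif >-> R} := HB.pack (idfun : measurableTypeR R -> R) mX.
exists X; rewrite /continuously_distributed (_ : distr_fun X = unif_cdf).
  exact: unif_cdf_continuous.
by apply/funext => x; apply: EFin_inj; rewrite distr_funE -law_itv.
Qed.

End uniform_distribution_function.

Lemma comonotone_is_copula (R : realType) : is_copula (@comonotone_copula R).
Proof.
rewrite /comonotone_copula; split.
- move=> u /andP[u0 u1]; split; first by apply/min_idPr.
  by apply/min_idPl.
- move=> u /andP[u0 u1]; split; first by apply/min_idPl.
  by apply/min_idPr.
move=> u1 v1 u2 v2 ? ? ? ? ? ?.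
by case: (leP v1 v2); case: (leP v1 u2); case: (leP u1 v2);
  case: (leP u1 u2) => *; lra.
Qed.

Lemma copula_self d (T : measurableType d) (R : realType) (P : probability T R)
  (X : {RV P >-> R}) : copula_of X X (@comonotone_copula R).
Proof.
split; first exact: comonotone_is_copula.
move=> x1 x2; have mF : distr_fun X (Num.min x1 x2) =
    Num.min (distr_fun X x1) (distr_fun X x2).
  have [h|/ltW h] := leP x1 x2; apply/esym.
    by apply/min_idPl; exact: distr_fun_nd.
  by apply/min_idPr; exact: distr_fun_nd.
rewrite /comonotone_copula -mF -pr_RV_le; congr (fine (P _)).
by apply/seteqP; split => w /=; rewrite le_min => /andP.
Qed.

(** Equality case of Cauchy-Schwarz: if the correlation of [Y] and [Z] is
    [eps = 1] or [eps = -1], then [Z] is almost surely an affine function of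
    [Y] with slope [eps * t / s], where [s] and [t] are the standard
    deviations. *)
Lemma extremal_correlation d (T : measurableType d) (R : realType)
    (P : probability T R) (Y Z : T -> R) (s t eps : R) :
  Y \in Lfun P 2%:E -> Z \in Lfun P 2%:E -> 0 < s -> 0 < t -> eps ^+ 2 = 1 ->
  var P Y = s ^+ 2 -> var P Z = t ^+ 2 -> cov P Y Z = eps * (s * t) ->
  exists e, {ae P, forall w, Z w = eps * (t / s) * Y w + e}.
Proof.
move=> Y2 Z2 s0 t0 eps1 vY vZ cYZ.
have A2 := L2_Z (eps * t) Y2; have B2 := L2_Z s Z2.
(* The variance of eps t Y - s Z is s^2 t^2 (1 - eps^2). *)
have v0 : var P ((eps * t) \o* Y \- s \o* Z) = 0.
  rewrite varB// !varZ// covZl// covC covZl// covC vY vZ cYZ.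
  have -> : (eps * t) ^+ 2 * s ^+ 2 + s ^+ 2 * t ^+ 2 -
      2 * (eps * t * (s * (eps * (s * t)))) =
    s ^+ 2 * t ^+ 2 * (1 - eps ^+ 2) by ring.
  by rewrite eps1 subrr mulr0.
have := var0_ae_cst (L2_B A2 B2) v0; set c := fine _ => h.
exists (- c / s); apply: filterS h => w /= <-.
by field; rewrite gt_eqF.
Qed.

Lemma pearsonE d (T : measurableType d) (R : realType) (P : probability T R)
    (Y Z : T -> R) :
  pearson P Y Z = cov P Y Z / (Num.sqrt (var P Y) * Num.sqrt (var P Z)).
Proof. by []. Qed.

Section extremal_coefficients.
Context (R : realType) (G1 G2 : cumulativeBounded (0 : R) (1 : R)).
Hypothesis K : measure_of_concordance (transformed_rank_corr G1 G2).

Lemma measure_of_concordance_same_type :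
  exists G : cumulativeBounded (0 : R) (1 : R),
    [/\ non_degenerate_distr G, symmetric_distr G,
        finite_second_moment_distr G, same_type G G1 & same_type G G2].
Proof.
have [X cX] := continuous_RV_exists R.
set P := law _ in X cX.
have cX' := opp_continuously_distributed cX.
have [/= nd1 f1 nd2 f2] := concordance_domain K cX cX.
have YG1 := rank_transform_law G1 cX; have YG2 := rank_transform_law G2 cX.
have YG2' := rank_transform_law G2 cX'.
move/(has_law_non_degenerate YG1) : (nd1) => Gnd1.
move/(has_law_non_degenerate YG2) : (nd2) => Gnd2.
move/(has_law_finite_second_moment YG1) : (f1) => Gf1.
move/(has_law_finite_second_moment YG2) : (f2) => Gf2.
have Y12 := rank_transform_L2 Gf1 cX; have Y22 := rank_transform_L2 Gf2 cX.
have Y22' := rank_transform_L2 Gf2 cX'.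
have v1 := law_var_gt0 Gnd1 Gf1; have v2 := law_var_gt0 Gnd2 Gf2.
set s := Num.sqrt (law_var G1); set t := Num.sqrt (law_var G2).
have s0 : 0 < s by rewrite sqrtr_gt0.
have t0 : 0 < t by rewrite sqrtr_gt0.
have ss : law_var G1 = s ^+ 2 by rewrite sqr_sqrtr// ltW.
have tt : law_var G2 = t ^+ 2 by rewrite sqr_sqrtr// ltW.
have [_ /(_ (copula_self X)) k1 _] := concordance_range K cX cX.
have kN := concordance_change_of_sign K cX cX; rewrite k1 in kN.
move: k1 kN; rewrite /= !pearsonE.
rewrite !(var_has_law YG1) !(var_has_law YG2) !(var_has_law YG2').
rewrite -/s -/t => k1 kN.
have st0 : s * t != 0 by rewrite mulf_neq0// gt_eqF.
have c1 : cov P (rank_transform G1 X) (rank_transform G2 X) = 1 * (s * t).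
  by rewrite -[LHS](mulfVK st0) k1.
have cN : cov P (rank_transform G1 X) (rank_transform G2 (opp_RV X)) =
    -1 * (s * t).
  by rewrite -[LHS](mulfVK st0) kN.
have [m h1] := extremal_correlation Y12 Y22 s0 t0 (expr1n _ _)
  (etrans (var_has_law YG1) ss) (etrans (var_has_law YG2) tt) c1.
have [m' hN] := extremal_correlation Y12 Y22' s0 t0
  (etrans (sqrrN _) (expr1n _ _)) (etrans (var_has_law YG1) ss)
  (etrans (var_has_law YG2') tt) cN.
set c := t / s; have c0 : 0 < c by exact: divr_gt0.
have lawE Z a b : has_law P Z G2 ->
    {ae P, forall w, Z w = a * rank_transform G1 X w + b} ->
    forall A : set R, measurable A ->
    law G2 A = law G1 ((fun y : R => a * y + b) @^-1` A).
  move=> [mZ ZG] ZE A mA.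
  have maff : measurable_fun setT (fun y : R => a * y + b).
    by apply: measurable_funD => //; exact: measurable_funM.
  have mA' : measurable ((fun y : R => a * y + b) @^-1` A).
    by rewrite -[X in measurable X]setTI; exact: maff.
  have [mY YG] := YG1; rewrite -ZG// -YG//; apply: ae_eq_measure.
  - by rewrite -[X in measurable X]setTI; exact: mZ.
  - by rewrite -[X in measurable X]setTI; exact: mY.
  - by apply: filterS ZE => w /= ->.
have l1 := lawE _ _ _ YG2 h1; have lN := lawE _ _ _ YG2' hN.
rewrite mul1r -/c in l1; rewrite mulN1r -/c in lN.
exists G1; split => //.
- (* Since c Y + m and - c Y + m' have the same law, so have Y and
     - Y + (m' - m) / c, and the centre of symmetry is half this translation. *)
  exists ((m' - m) / (2 * c)) => B mB; rewrite /pushforward.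
  set m0 := (m' - m) / _.
  pose f (a : R) := (a - m) / c - m0.
  have mf : measurable_fun setT f.
    apply: measurable_funB => //; apply: measurable_funM => //.
    exact: measurable_funB.
  have mfB : measurable (f @^-1` B).
    by rewrite -[X in measurable X]setTI; exact: mf.
  transitivity (law G1 ((fun y : R => c * y + m) @^-1` (f @^-1` B))).
    congr (law G1 _).
    by apply/seteqP; split => y /=; rewrite /f addrK mulrC mulKf ?gt_eqF.
  rewrite -l1// lN//; congr (law G1 _).
  have fE y : f (- c * y + m') = m0 - y.
    by rewrite /f /m0; field; rewrite gt_eqF.
  by apply/seteqP; split => y /=; rewrite fE.
- exists 1, 0; split; first exact: ltr01.
  move=> A mA; congr (law G1 _).
  by apply/seteqP; split => y /=; rewrite mul1r addr0.
- by exists c, m; split => // A mA; rewrite l1.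
Qed.

End extremal_coefficients.

Theorem theorem1 (R : realType) (G1 G2 : cumulativeBounded (0 : R) (1 : R)) :
  measure_of_concordance (transformed_rank_corr G1 G2) <->
  exists G : cumulativeBounded (0 : R) (1 : R),
    [/\ non_degenerate_distr G, symmetric_distr G,
        finite_second_moment_distr G, same_type G G1 & same_type G G2].
Proof.
split; first exact: measure_of_concordance_same_type.
move=> [G [Gnd Gsym GL2 GG1 GG2]].
exact: (same_type_measure_of_concordance Gnd Gsym GL2 GG1 GG2).
Qed.
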